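(* There exist absolute constants $c,C>0$ such that for every finite set $A\subset\mathbb{R}$ with $|A|\ge 2$, $$|A(A+A)| \;\ge\; C\,\frac{|A|^{\frac32+\frac5{242}}}{(\log |A(A+A)|)^{c}}.$$
   Context: All logarithms are base $2$. $A(A+A):=\{a(b+c): a,b,c\in A\}$. The paper writes this conclusion as $|A(A+A)|\gtrapprox |A|^{3/2+5/242}$, where $X\gtrapprox Y$ means that there is an absolute constant $c>0$ such that $X\gg Y/(\log X)^c$, and $X\gg Y$ means $X\ge C Y$ for some absolute constant $C>0$. *)

(* Defs.v *)
From mathcomp Require Import all_boot all_order all_algebra finmap.
From mathcomp Require Import all_classical all_reals all_analysis.

Set Implicit Arguments.
Unset Strict Implicit.
Unset Printing Implicit Defensive.

Local Open Scope fset_scope.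
Local Open Scope ring_scope.

Definition sumset (R : realType) (A B : {fset R}) : {fset R} :=
  [fset a + b | a in A, b in B].

Definition prodset (R : realType) (A B : {fset R}) : {fset R} :=
  [fset a * b | a in A, b in B].

Definition log2 (R : realType) (x : R) : R := ln x / ln 2.

(* Main.v *)
Require Import Defs.
From mathcomp Require Import all_boot all_order all_algebra finmap.
From mathcomp Require Import all_classical all_reals all_analysis.
From mathcomp Require Import ring lra zify.

(** We may assume that [A] is positive. Put [n = |A|], [N = |A(A+A)|], and
    ignore constants and powers of [log n]. Everything rests on incidence
    bounds for increasing curves in a grid; cutting the grid into blocks proves
    them without the general Szemeredi-Trotter theorem.

    (1) Counting the solutions of [a(b+c) = a'(b'+c')] by the slope [a/a'] and
    bounding collinear triples of [A * A] gives [n^6 <= N^2 E], where [E] is the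
    multiplicative energy of [A].

    (2) If [E] is large, choose dyadically a set of popular ratios and a set
    [A'] of [m] elements of [A] that many popular ratios send into [A]. The
    curves [s = a/x + b] show that [A'] is additively unstructured:
    [sum_s r_{A'+B}(s)^3 <= D |B|^2] for all [B], where [D <= n^3 m^4 / E^2].

    (3) For such a set, counting up to translation the triples [(a, b, c)] with
    [a + b] a popular sum and [b - c] a popular difference yields
    [m^94 <= |A'+A'|^44 D^25].

    As [|A'+A'| <= N] and [m <= n], these combine to [n^219 <= N^144]: the
    exponent is [219/144 = 3/2 + 1/48], slightly more than [3/2 + 5/242]. *)

Set Implicit Arguments.
Unset Strict Implicit.
Unset Printing Implicit Defensive.
Import Order.TTheory GRing.Theory Num.Theory.

Local Open Scope ring_scope.

(** * Sums over finite lists *)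

Section FiniteSums.
Variable R : realFieldType.

(** After doubling, both sides are sums over pairs [(i, j)], and [2 u_i u_j <= v_i w_j + v_j w_i]
    holds termwise by AM-GM. The hypothesis [u^2 <= v w] avoids square roots. *)
Lemma cauchy_schwarz (I : Type) (s : seq I) (u v w : I -> R) :
  (forall i, 0 <= v i) -> (forall i, 0 <= w i) ->
  (forall i, u i ^+ 2 <= v i * w i) ->
  (\sum_(i <- s) u i) ^+ 2 <= (\sum_(i <- s) v i) * (\sum_(i <- s) w i).
Proof.
move=> v0 w0 uvw; rewrite expr2 !big_distrlr /=.
rewrite -(ler_pM2l (ltr0Sn R 1)) -[2%:R]/(1 + 1) !mulrDl !mul1r.
rewrite [X in _ <= _ + X]exchange_big /= -!big_split /=.
apply: ler_sum => i _; rewrite -!big_split /=; apply: ler_sum => j _.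
have [a0 b0] : 0 <= v i * w j /\ 0 <= v j * w i by rewrite !mulr_ge0.
have h : (u i * u j) ^+ 2 <= (v i * w j) * (v j * w i).
  have -> : (v i * w j) * (v j * w i) = (v i * w i) * (v j * w j) by ring.
  by rewrite exprMn ler_pM ?sqr_ge0.
move: (u i * u j) (v i * w j) (v j * w i) a0 b0 h => x a b a0 b0 h.
have [x0|x0] := leP x 0; first by lra.
rewrite -ler_sqr ?nnegrE; [|lra|lra].
have := sqr_ge0 (a - b); nra.
Qed.

(** Let [X] and [Y] be the sums of [f^2 g] and [f g^2], and [F], [G] the sums of cubes.
    Cauchy-Schwarz gives [X^2 <= F Y] and [Y^2 <= G X], so [X^4 <= F^2 G X]; divide by [X]. *)
Lemma holder21 (I : Type) (s : seq I) (f g : I -> R) :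
  (forall i, 0 <= f i) -> (forall i, 0 <= g i) ->
  (\sum_(i <- s) f i ^+ 2 * g i) ^+ 3 <=
  (\sum_(i <- s) f i ^+ 3) ^+ 2 * \sum_(i <- s) g i ^+ 3.
Proof.
move=> f0 g0.
have h1 : (\sum_(i <- s) f i ^+ 2 * g i) ^+ 2 <=
    (\sum_(i <- s) f i ^+ 3) * (\sum_(i <- s) f i * g i ^+ 2).
  apply: cauchy_schwarz => i; rewrite ?mulr_ge0 ?exprn_ge0 //.
  by rewrite le_eqVlt; apply/orP; left; apply/eqP; ring.
have h2 : (\sum_(i <- s) f i * g i ^+ 2) ^+ 2 <=
    (\sum_(i <- s) g i ^+ 3) * (\sum_(i <- s) f i ^+ 2 * g i).
  apply: cauchy_schwarz => i; rewrite ?mulr_ge0 ?exprn_ge0 //.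
  by rewrite le_eqVlt; apply/orP; left; apply/eqP; ring.
have X0 : 0 <= \sum_(i <- s) f i ^+ 2 * g i.
  by rewrite sumr_ge0 // => i _; rewrite mulr_ge0 ?exprn_ge0.
have Y0 : 0 <= \sum_(i <- s) f i * g i ^+ 2.
  by rewrite sumr_ge0 // => i _; rewrite mulr_ge0 ?exprn_ge0.
have F0 : 0 <= \sum_(i <- s) f i ^+ 3.
  by rewrite sumr_ge0 // => i _; rewrite exprn_ge0.
have G0 : 0 <= \sum_(i <- s) g i ^+ 3.
  by rewrite sumr_ge0 // => i _; rewrite exprn_ge0.
move: (\sum_(i <- s) f i ^+ 2 * g i) (\sum_(i <- s) f i * g i ^+ 2) 
  (\sum_(i <- s) f i ^+ 3) (\sum_(i <- s) g i ^+ 3) h1 h2 X0 Y0 F0 G0.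
move=> X Y F G h1 h2 X0 Y0 F0 G0.
have [->|Xn] := eqVneq X 0; first by rewrite expr0n /= mulr_ge0 ?exprn_ge0.
have Xp : 0 < X by rewrite lt_neqAle eq_sym Xn.
rewrite -(ler_pM2r Xp) -exprSr.
have -> : X ^+ 4 = (X ^+ 2) ^+ 2 by ring.
apply: (@le_trans _ _ ((F * Y) ^+ 2)); first by rewrite ler_sqr ?nnegrE ?exprn_ge0 ?mulr_ge0.
rewrite exprMn -[leRHS]mulrA; apply: ler_wpM2l; [exact: exprn_ge0|exact: h2].
Qed.

Lemma sum_cube (I : Type) (s : seq I) (g : I -> R) : (forall i, 0 <= g i) ->
  (\sum_(i <- s) g i) ^+ 3 <= (size s)%:R ^+ 2 * \sum_(i <- s) g i ^+ 3.
Proof.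
move=> g0; have := @holder21 I s (fun=> 1) g (fun=> ler01) g0.
rewrite (eq_bigr g) => [|i _]; last by rewrite expr1n mul1r.
by rewrite expr1n big_const_seq count_predT iter_addr_0.
Qed.

Lemma pigeonhole (I : eqType) (s : seq I) (J : nat) (k : I -> nat) (w : I -> R) :
  (0 < J)%N -> (forall i, i \in s -> (k i < J)%N) ->
  exists j, \sum_(i <- s) w i <= J%:R * \sum_(i <- s | k i == j) w i.
Proof.
move=> J0 kJ; have E : \sum_(i <- s) w i = \sum_(j < J) \sum_(i <- s | k i == j) w i.
  rewrite (exchange_big_dep xpredT) //= !big_seq; apply: eq_bigr => i /kJ ki.
  by rewrite (big_pred1 (Ordinal ki)) // => j; rewrite -val_eqE eq_sym.
have [/existsP[j h]|/existsPn h] :=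
    boolP [exists j : 'I_J, \sum_(i <- s) w i <= J%:R * \sum_(i <- s | k i == j) w i].
  by exists (val j).
have JR : 0 < J%:R :> R by rewrite ltr0n.
have : \sum_(j < J) (J%:R * \sum_(i <- s | k i == j) w i) <
       \sum_(j < J) \sum_(i <- s) w i.
  apply: ltr_sum => [|j _]; last by rewrite ltNge.
  by apply/hasP; exists (Ordinal J0); rewrite ?mem_index_enum.
by rewrite -mulr_sumr -E sumr_const card_ord -[ltRHS]mulr_natl ltxx.
Qed.

(** Pigeonhole on [trunc_log 2 (f i)]: one of the [J] dyadic classes carries at least a fraction
    [1/J] of the sum. *)
Lemma dyadic_level (I : eqType) (s : seq I) (J e : nat) (f : I -> nat) :
  (0 < J)%N -> (0 < e)%N -> {in s, forall i, (f i < 2 ^ J)%N} ->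
  exists j, \sum_(i <- s) (f i)%:R ^+ e <=
    J%:R * (size [seq i <- s | (2 ^ j <= f i < 2 ^ j.+1)%N])%:R * (2 ^+ j.+1) ^+ e :> R.
Proof.
move=> J0 e0 fJ; have kJ i : i \in s -> (trunc_log 2 (f i) < J)%N.
  move=> si; have [->|fi0] := posnP (f i); first by rewrite trunc_log0.
  by rewrite -(@ltn_exp2l 2) //; apply: leq_ltn_trans (fJ i si); exact: trunc_logP.
have [j hj] := pigeonhole (fun i => (f i)%:R ^+ e) J0 kJ.
exists j; apply: le_trans hj _; rewrite -mulrA; apply: ler_wpM2l => //.
rewrite -sum1_size natr_sum mulr_suml big_filter big_mkcond [leRHS]big_mkcond.
apply: ler_sum => i _; case: eqP => [<-|_]; last first.
  by case: ifP => // _; rewrite mul1r !exprn_ge0.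
(* Zeros share class 0 with the value 1 but fail [1 <= f i]; their terms vanish because [e > 0]. *)
have [->|fi0] := posnP (f i).
  by rewrite [0%:R]mulr0n expr0n eqn0Ngt e0 trunc_log0.
rewrite trunc_logP // trunc_log_ltn //= mul1r.
by rewrite lerXn2r ?nnegrE ?exprn_ge0 // -natrX ler_nat ltnW // trunc_log_ltn.
Qed.

(** * Fibers and collisions of maps on finite lists *)

Section Fibers.
Variables (I T : eqType).
Implicit Types (f : I -> T) (X : seq I).

Definition fib f X (v : T) : R := (count (fun x => f x == v) X)%:R.

Lemma fib_ge0 f X v : 0 <= fib f X v. Proof. exact: ler0n. Qed.

Lemma fibE f X v : fib f X v = \sum_(x <- X) (f x == v)%:R.
Proof. by rewrite /fib -sum1_count natr_sum big_mkcond; apply: eq_bigr => i _; case: eqP. Qed.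

Lemma sum_indic (V : seq T) (v : T) (F : T -> R) : uniq V ->
  \sum_(w <- V) (v == w)%:R * F w = (v \in V)%:R * F v.
Proof.
move=> uV; have [vV|vV] := boolP (v \in V).
  rewrite (bigD1_seq v) //= eqxx big1 ?addr0 // => w /negPf.
  by rewrite eq_sym => ->; rewrite mul0r.
rewrite mul0r big_seq big1 // => w wV; case: eqP => [vw|_]; last by rewrite mul0r.
by rewrite vw wV in vV.
Qed.

Lemma sum_indic1 (V : seq T) (v : T) : uniq V ->
  \sum_(w <- V) (v == w)%:R = (v \in V)%:R :> R.
Proof.
move=> uV; rewrite -[RHS]mulr1 -(sum_indic _ (fun=> 1) uV).
by apply: eq_bigr => w _; rewrite mulr1.
Qed.

Lemma sum_fib f X (V : seq T) (F : T -> R) : uniq V ->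
  {in X, forall x, f x \in V} ->
  \sum_(x <- X) F (f x) = \sum_(v <- V) fib f X v * F v.
Proof.
move=> uV fV; under [RHS]eq_bigr do rewrite fibE mulr_suml.
rewrite exchange_big /= !big_seq; apply: eq_bigr => x xX.
by rewrite sum_indic // fV // mul1r.
Qed.

Lemma sum_fib1_le f X (V : seq T) : uniq V ->
  \sum_(v <- V) fib f X v <= (size X)%:R.
Proof.
move=> uV; under eq_bigr do rewrite fibE.
rewrite exchange_big /= -sum1_size natr_sum; apply: ler_sum => x _.
by rewrite sum_indic1 // lern1 leq_b1.
Qed.

Lemma sum_fib1 f X (V : seq T) : uniq V -> {in X, forall x, f x \in V} ->
  \sum_(v <- V) fib f X v = (size X)%:R.
Proof.
move=> uV fV; rewrite -sum1_size natr_sum (sum_fib (fun=> 1) uV fV).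
by apply: eq_bigr => v _; rewrite mulr1.
Qed.

End Fibers.

Section Collisions.
Variables (I I' T : eqType).

(** With [f = g] and [X = Y] this is an energy; the additive energies below are instances. *)
Definition coll (f : I -> T) (X : seq I) (g : I' -> T) (Y : seq I') : R :=
  \sum_(x <- X) \sum_(y <- Y) (f x == g y)%:R.

Lemma coll_fib (f : I -> T) X (g : I' -> T) Y (V : seq T) : uniq V ->
  {in X, forall x, f x \in V} ->
  coll f X g Y = \sum_(v <- V) fib f X v * fib g Y v.
Proof.
move=> uV fV; rewrite -(sum_fib (fib g Y) uV fV).
by apply: eq_bigr => x _; rewrite fibE; apply: eq_bigr => y _; rewrite eq_sym.
Qed.

End Collisions.

Lemma coll_cs (I I' T : eqType) (f : I -> T) X (g : I' -> T) Y :
  coll f X g Y ^+ 2 <= coll f X f X * coll g Y g Y.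
Proof.
pose V := undup (map f X ++ map g Y); have uV : uniq V by exact: undup_uniq.
have fV : {in X, forall x, f x \in V}.
  by move=> x xX; rewrite mem_undup mem_cat map_f.
have gV : {in Y, forall x, g x \in V}.
  by move=> x xX; rewrite mem_undup mem_cat (map_f g) // orbT.
rewrite (coll_fib g Y uV fV) (coll_fib f X uV fV) (coll_fib g Y uV gV).
apply: cauchy_schwarz => v; rewrite ?mulr_ge0 ?fib_ge0 //.
by rewrite le_eqVlt; apply/orP; left; apply/eqP; ring.
Qed.

(** Cauchy-Schwarz over the fibers: a small image forces many collisions. *)
Lemma size_sq_le_coll (I T : eqType) (f : I -> T) X (V : seq T) :
  uniq V -> {in X, forall x, f x \in V} ->
  (size X)%:R ^+ 2 <= (size V)%:R * coll f X f X.
Proof.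
move=> uV fV; rewrite (coll_fib f X uV fV) -(sum_fib1 uV fV).
rewrite -[size V]sum1_size natr_sum.
apply: cauchy_schwarz => v; rewrite ?mulr_ge0 ?fib_ge0 //.
by rewrite mul1r expr2.
Qed.

End FiniteSums.

(** * Rich curves in a grid *)

(** Adding elements one at a time, each brings a new value of [f] or forms a pair with an element
    already present. *)
Lemma size_le_pairs (T : eqType) (f : T -> nat) (X : seq T) : uniq X ->
  (size X <= \sum_(p <- X) count (fun q => (q != p) && (f q == f p)) X
             + size (undup (map f X)))%N.
Proof.
elim: X => [|x X IH] //= /andP[xX uX]; rewrite big_cons /= eqxx /= add0n.
have -> : (\sum_(p <- X) ((x != p) && (f x == f p) +
      count (fun q => (q != p) && (f q == f p)) X) =
    \sum_(p <- X) ((x != p) && (f x == f p)) +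
    \sum_(p <- X) count (fun q => (q != p) && (f q == f p)) X)%N.
  by rewrite big_split.
have := IH uX; case: ifP => [/mapP[y yX fxy]|_] /=; last by lia.
have : (0 < count (fun q => (q != x) && (f q == f x)) X)%N.
  rewrite -has_count; apply/hasP; exists y => //; rewrite -fxy eqxx andbT.
  by apply: contraNneq xX => <-.
lia.
Qed.

Lemma count_le1 (T : eqType) (P : pred T) (X : seq T) : uniq X ->
  {in X &, forall i j, P i -> P j -> i = j} -> (count P X <= 1)%N.
Proof.
move=> uX h; rewrite -size_filter.
case E : (seq.filter P X) => [|x [|y s]] //.
have := filter_uniq P uX; rewrite E /= inE => /andP[/norP[/eqP xy _] _].
have: x \in seq.filter P X by rewrite E inE eqxx.
have: y \in seq.filter P X by rewrite E !inE eqxx orbT.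
rewrite !mem_filter => /andP[Py yX] /andP[Px xX].
by case: xy; apply: h.
Qed.

Lemma add_eq_of_le (x y z w : nat) : (x <= y)%N -> (z <= w)%N ->
  (y + w = x + z)%N -> y = x /\ w = z.
Proof. lia. Qed.

Section Incidences.
Variable R : realDomainType.

(** Position of [u] in the increasing order of [U], obtained by counting so that [U] need not be
    sorted. *)
Definition rank (U : seq R) (u : R) : nat := count (fun x => x < u) U.

Lemma rank_le (U : seq R) (u v : R) : u <= v -> (rank U u <= rank U v)%N.
Proof. by move=> uv; apply: sub_count => x /= /lt_le_trans; apply. Qed.

Lemma rank_lt (U : seq R) (u v : R) : u \in U -> u < v -> (rank U u < rank U v)%N.
Proof.
move=> uU uv; elim: U uU => [|x U IH] //=; have := rank_le U (ltW uv).
rewrite inE /rank /= => h /predU1P[<-|/IH]; first by rewrite ltxx uv add0n add1n ltnS.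
have := rank_le [:: x] (ltW uv); rewrite /rank /= !addn0; lia.
Qed.

Lemma rank_ltn_size (U : seq R) (u : R) : u \in U -> (rank U u < size U)%N.
Proof.
move=> uU; rewrite /rank ltn_neqAle count_size andbT -all_count.
by apply/negP => /allP/(_ u uU); rewrite ltxx.
Qed.

Lemma rank_inj (U : seq R) : {in U &, injective (rank U)}.
Proof.
move=> u v uU vU e; case: (ltgtP u v) => // h.
  by have := rank_lt uU h; rewrite e ltnn.
by have := rank_lt vU h; rewrite e ltnn.
Qed.

Lemma block_size (U : seq R) (k b : nat) : uniq U -> (0 < k)%N ->
  (count (fun u => rank U u %/ k == b) U <= k)%N.
Proof.
move=> uU k0; rewrite -size_filter -(size_map (rank U)) -[X in (_ <= X)%N](size_iota (b * k)).
apply: uniq_leq_size => [|x /mapP[u]].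
  rewrite map_inj_in_uniq ?filter_uniq // => u v.
  by rewrite !mem_filter => /andP[_ uU'] /andP[_ vU]; exact: rank_inj.
rewrite mem_filter mem_iota => /andP[/eqP<- _ ->].
by rewrite leq_divM /= -mulSnr; exact: ltn_ceil.
Qed.

Lemma count_same_cell (U V : seq R) (k l : nat) : uniq U -> uniq V ->
  (0 < k)%N -> (0 < l)%N ->
  let G := [seq (u, v) | u <- U, v <- V] in
  (\sum_(p <- G) count (fun q => (rank U q.1 %/ k == rank U p.1 %/ k) &&
      (rank V q.2 %/ l == rank V p.2 %/ l)) G
    <= size U * size V * (k * l))%N.
Proof.
move=> uU uV k0 l0 /=; set G := [seq _ | _ <- _, _ <- _].
rewrite -(size_allpairs pair U V) -/G -sum1_size big_distrl /=.
apply: leq_sum => p _; rewrite mul1n.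
rewrite -sum1_count big_mkcond big_allpairs /=.
apply: (@leq_trans (\sum_(u <- U | rank U u %/ k == rank U p.1 %/ k) l)%N); last first.
  by rewrite big_const_seq iter_addn_0 mulnC leq_mul2r block_size ?orbT.
rewrite [X in (_ <= X)%N]big_mkcond /=; apply: leq_sum => u _.
case: eqP => _ /=; last by rewrite big1.
by rewrite -big_mkcond sum1_count block_size.
Qed.

(** Two points of an increasing curve agree in one coordinate exactly when they agree in the other,
    so both projections are injective on it. *)
Lemma count_increasing (U V : seq R) (c : pred (R * R)) :
  uniq U -> uniq V ->
  let G := [seq (u, v) | u <- U, v <- V] in
  {in G &, forall p q, c p -> c q -> (p.1 < q.1) = (p.2 < q.2)} ->
  (count c G <= minn (size U) (size V))%N.
Proof.
move=> uU uV G mono; have uG : uniq G by apply: allpairs_uniq => // -[? ?] [? ?] _ _ [-> ->].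
have eq12 p q : p \in G -> q \in G -> c p -> c q -> (p.1 == q.1) = (p.2 == q.2).
  by move=> pG qG cp cq; rewrite !eq_le !leNgt (mono p q) // (mono q p).
rewrite leq_min -size_filter; apply/andP; split.
  rewrite -(size_map fst); apply: uniq_leq_size => [|u /mapP[p]].
    rewrite map_inj_in_uniq ?filter_uniq // => p q.
    rewrite !mem_filter => /andP[cp pG] /andP[cq qG] /eqP e1.
    have := e1; rewrite eq12 // => /eqP e2; move/eqP: e1.
    by case: p q e2 {cp pG cq qG} => ? ? [? ?] /= -> ->.
  by rewrite mem_filter => /andP[_ /allpairsP[[a b] [/= aU _ ->]]] ->.
rewrite -(size_map snd); apply: uniq_leq_size => [|u /mapP[p]].
  rewrite map_inj_in_uniq ?filter_uniq // => p q.
  rewrite !mem_filter => /andP[cp pG] /andP[cq qG] /eqP e2.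
  have := e2; rewrite -eq12 // => /eqP e1; move/eqP: e2.
  by case: p q e1 {cp pG cq qG} => ? ? [? ?] /= -> ->.
by rewrite mem_filter => /andP[_ /allpairsP[[a b] [/= _ bV ->]]] ->.
Qed.

(* Cut the grid into [r * r] blocks of consecutive rows and columns. The block
   coordinates of an increasing curve have a strictly increasing sum, so the
   curve meets fewer than [2 r] blocks; if [r] is about [t / 4], many pairs of
   its points share a block, and such a pair determines the curve. *)
Lemma rich_curves (I : eqType) (U V : seq R) (Ls : seq I)
    (inc : I -> R * R -> bool) (t : nat) :
  uniq U -> uniq V -> uniq Ls ->
  let G := [seq (u, v) | u <- U, v <- V] in
  {in Ls, forall i, {in G &, forall p q, inc i p -> inc i q ->
    (p.1 < q.1) = (p.2 < q.2)}} ->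
  {in Ls &, forall i j, {in G &, forall p q, p != q ->
    inc i p -> inc i q -> inc j p -> inc j q -> i = j}} ->
  (2 <= t)%N -> {in Ls, forall i, (t <= count (inc i) G)%N} ->
  (size Ls * t ^ 3 <= 2 ^ 9 * (size U * size V) ^ 2)%N.
Proof.
move=> uU uV uL G H1 H2 t2 rich.
have uG : uniq G by apply: allpairs_uniq => // -[? ?] [? ?] _ _ [-> ->].
case: Ls uL H1 H2 rich => [|i0 L0] //; set Ls := i0 :: L0 => uL H1 H2 rich.
have i0L : i0 \in Ls by rewrite inE eqxx.
clearbody Ls.
have [tU tV] : (t <= size U)%N /\ (t <= size V)%N.
  apply/andP; rewrite -leq_min; apply: leq_trans (rich _ i0L) _.
  exact: count_increasing uU uV (H1 _ i0L).
(* The upper bound on [r] makes [2 r - 1], the number of blocks a curve can meet, at most [t / 2];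
   the lower bound [t <= 8 r] is used at the very end. *)
pose r := maxn 1 (t %/ 4); have r0 : (0 < r)%N by rewrite leq_max.
have rt : (2 * (2 * r - 1) <= t)%N /\ (t <= 8 * r)%N by rewrite /r; lia.
clearbody r.
(* The successor makes [k * r] exceed [size U], so block indices stay below [r]; since
   [r <= t <= size U], it still is at most [2 * size U]. *)
pose k := (size U %/ r).+1; pose l := (size V %/ r).+1.
have kr : (k * r <= 2 * size U)%N.
  by have := leq_divM (size U) r; rewrite /k mulSn; lia.
have lr : (l * r <= 2 * size V)%N.
  by have := leq_divM (size V) r; rewrite /l mulSn; lia.
pose bu (p : R * R) := (rank U p.1 %/ k)%N; pose bv (p : R * R) := (rank V p.2 %/ l)%N.
pose kap p := (bu p + bv p)%N.
have kapK p : p \in G -> (kap p < 2 * r - 1)%N.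
  case/allpairsP => -[u v] [/= uU' vV ->]; rewrite /kap /bu /bv /=.
  have h1 : (rank U u %/ k < r)%N.
    rewrite ltn_divLR // mulnC; apply: leq_trans (rank_ltn_size uU') _.
    by rewrite mulnC /k mulnC; apply/ltnW/ltn_ceil.
  have h2 : (rank V v %/ l < r)%N.
    rewrite ltn_divLR // mulnC; apply: leq_trans (rank_ltn_size vV) _.
    by rewrite mulnC /l mulnC; apply/ltnW/ltn_ceil.
  by move: (rank U u %/ k)%N (rank V v %/ l)%N h1 h2 => x y; lia.
(* Both block coordinates are monotone along a curve, so equal sums force equal coordinates. *)
have kap_cell i p q : i \in Ls -> p \in G -> q \in G -> inc i p -> inc i q ->
    kap q == kap p -> (bu q == bu p) && (bv q == bv p).
  move=> iL pG qG ip iq.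
  wlog pq : p q pG qG ip iq / p.1 <= q.1.
    move=> W; have [/W|/ltW qp e] := leP p.1 q.1; first exact.
    by rewrite eq_sym [bv q == _]eq_sym; apply: W => //; rewrite eq_sym.
  have pq2 : p.2 <= q.2 by rewrite leNgt -(H1 i) // -leNgt.
  have hu : (bu p <= bu q)%N by apply/leq_div2r/rank_le.
  have hv : (bv p <= bv q)%N by apply/leq_div2r/rank_le.
  by rewrite /kap => /eqP/(add_eq_of_le hu hv)[-> ->]; rewrite !eqxx.
(* The curve has at least [t] points but at most [t / 2] values of [kap], so [size_le_pairs] leaves
   at least [t / 2] ordered pairs in a common block. *)
have pairs i : i \in Ls -> (t <= 2 * \sum_(p <- G) \sum_(q <- G)
     [&& q != p, bu q == bu p, bv q == bv p, inc i p & inc i q])%N.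
  move=> iL; have := size_le_pairs kap (filter_uniq (inc i) uG).
  have : (size (undup [seq kap x | x <- G & inc i x]) <= 2 * r - 1)%N.
    rewrite -[X in (_ <= X)%N](size_iota 0); apply: uniq_leq_size (undup_uniq _) _.
    move=> x; rewrite mem_undup => /mapP[p]; rewrite mem_filter => /andP[_ pG] ->.
    by rewrite mem_iota add0n kapK.
  have := rich i iL; rewrite -size_filter.
  suff : (\sum_(p <- G | inc i p) count (fun q => (q != p) && (kap q == kap p))
        (seq.filter (inc i) G) <=
    \sum_(p <- G) \sum_(q <- G)
     [&& q != p, bu q == bu p, bv q == bv p, inc i p & inc i q])%N.
    rewrite big_filter; move: (\sum_(p <- G | inc i p) _)%N (\sum_(p <- G) _)%N => a b.
    by move: rt.1 (size _) (size _) => ? c d; lia.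
  rewrite big_mkcond /= big_seq [X in (_ <= X)%N]big_seq.
  apply: leq_sum => p pG; case: ifP => // ip.
  rewrite count_filter -sum1_count big_mkcond /= big_seq [X in (_ <= X)%N]big_seq.
  apply: leq_sum => q qG; case: ifP => // /andP[/andP[qp e] iq].
  by have := kap_cell i p q iL pG qG ip iq e; rewrite qp iq => /andP[-> ->].
(* Two distinct points lie on at most one curve, so the sum over all curves counts each pair in a
   common block at most once. *)
have total : (size Ls * t <= 2 * (size U * size V * (k * l)))%N.
  apply: (@leq_trans (2 * \sum_(i <- Ls) \sum_(p <- G) \sum_(q <- G)
     [&& q != p, bu q == bu p, bv q == bv p, inc i p & inc i q])%N).
    rewrite big_distrr /= -sum1_size big_distrl /= big_seq [X in (_ <= X)%N]big_seq.
    by apply: leq_sum => i iL; rewrite mul1n pairs.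
  rewrite leq_mul2l /=; apply: leq_trans (count_same_cell uU uV _ _) => //.
  rewrite -/G exchange_big /= big_seq [X in (_ <= X)%N]big_seq.
  apply: leq_sum => p pG; rewrite exchange_big /= -sum1_count [X in (_ <= X)%N]big_mkcond /=.
  rewrite big_seq [X in (_ <= X)%N]big_seq; apply: leq_sum => q qG.
  rewrite -/(bu q) -/(bu p) -/(bv q) -/(bv p).
  case: (boolP (q != p)) => [qp|_]; last by rewrite big1.
  case: (bu q == bu p) => /=; last by rewrite big1.
  case: (bv q == bv p) => /=; last by rewrite big1.
  have -> : (\sum_(i <- Ls) (inc i p && inc i q) =
             count (fun i => inc i p && inc i q) Ls)%N.
    by rewrite -sum1_count [RHS]big_mkcond; apply: eq_bigr => i _; case: (_ && _).
  apply: count_le1 => // i j iL jL /andP[ip iq] /andP[jp jq].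
  by apply: (H2 i j iL jL q p).
have e8 : ((k * r) * (l * r) <= 4 * (size U * size V))%N.
  by apply: leq_trans (leq_mul kr lr) _; rewrite mulnACA.
(* The factor [(8 * r) ^ 2] is at least [t ^ 2], and it clears the divisions by [r] hidden in [k]
   and [l]. *)
have : (size Ls * t * (8 * r) ^ 2 <= 2 ^ 9 * (size U * size V) ^ 2)%N.
  have -> : (size Ls * t * (8 * r) ^ 2 = 64 * (size Ls * t) * r ^ 2)%N by ring.
  apply: (@leq_trans (64 * (2 * (size U * size V * (k * l))) * r ^ 2)%N).
    by rewrite leq_mul2r leq_mul2l total !orbT.
  have -> : (64 * (2 * (size U * size V * (k * l))) * r ^ 2 =
     128 * (size U * size V) * ((k * r) * (l * r)))%N by ring.
  have -> : (2 ^ 9 * (size U * size V) ^ 2 =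
     128 * (size U * size V) * (4 * (size U * size V)))%N by ring.
  by rewrite leq_mul2l e8 orbT.
apply: leq_trans; rewrite expnS mulnA leq_mul2l leq_exp2r //.
by case: rt => _ ->; rewrite orbT.
Qed.

(** Split the curves dyadically by their number of points and apply [rich_curves] to each class;
    counts below [2 t] cost a factor [2 ^ 3]. Curves with at most one point escape [rich_curves],
    which needs [2 <= t], and give the linear term. *)
Lemma third_moment_nat (I : eqType) (U V : seq R) (Ls : seq I)
    (inc : I -> R * R -> bool) (J : nat) :
  uniq U -> uniq V -> uniq Ls ->
  let G := [seq (u, v) | u <- U, v <- V] in
  {in Ls, forall i, {in G &, forall p q, inc i p -> inc i q ->
    (p.1 < q.1) = (p.2 < q.2)}} ->
  {in Ls &, forall i j, {in G &, forall p q, p != q ->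
    inc i p -> inc i q -> inc j p -> inc j q -> i = j}} ->
  (0 < J)%N -> (size U < 2 ^ J)%N ->
  (\sum_(i <- Ls) count (inc i) G ^ 3 <=
     2 ^ 12 * J * (size U * size V) ^ 2 + \sum_(i <- Ls) count (inc i) G)%N.
Proof.
move=> uU uV uL G H1 H2 J0 UJ.
pose k i := trunc_log 2 (count (inc i) G).
have split (F : I -> nat) :
    (\sum_(i <- Ls) F i = \sum_(j < J) \sum_(i <- Ls | k i == j) F i)%N.
  rewrite (exchange_big_dep xpredT) //= !big_seq; apply: eq_bigr => i iL.
  have kJ : (k i < J)%N.
    have [c0|c0] := posnP (count (inc i) G).
      by rewrite /k c0 trunc_log0.
    have := count_increasing uU uV (H1 _ iL); rewrite leq_min => /andP[cU _].
    rewrite -(@ltn_exp2l 2) //; apply: leq_ltn_trans UJ.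
    by apply: leq_trans cU; exact: trunc_logP.
  by rewrite (big_pred1 (Ordinal kJ)) // => j; rewrite -val_eqE eq_sym.
rewrite (split (fun i => count (inc i) G ^ 3)%N) (split (fun i => count (inc i) G)).
rewrite mulnAC -[X in (_ <= _ * X + _)%N](card_ord J) mulnC -sum_nat_const -big_split /=.
apply: leq_sum => j _.
case: j => [[|j] /= _].
  apply: (@leq_trans (\sum_(i <- Ls | k i == 0%N) count (inc i) G)%N); last exact: leq_addl.
  apply: leq_sum => i; rewrite /k trunc_log_eq0 /=.
  by case: (count (inc i) G) => [|[|]].
apply: leq_trans (leq_addr _ _).
rewrite -big_filter; set L := seq.filter _ _.
have := @rich_curves I U V L inc (2 ^ j.+1) uU uV (filter_uniq _ uL).
have Lmem i : i \in L -> i \in Ls /\ (2 ^ j.+1 <= count (inc i) G < 2 ^ j.+2)%N.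
  rewrite mem_filter => /andP[/eqP ki ->]; split=> //; rewrite -ki.
  apply: trunc_log_bounds => //; rewrite lt0n; apply/eqP => c0.
  by move: ki; rewrite /k c0 trunc_log0.
rewrite -/G => rc.
have {}rc : (size L * (2 ^ j.+1) ^ 3 <= 2 ^ 9 * (size U * size V) ^ 2)%N.
  apply: rc.
  - by move=> i /Lmem[iL _]; exact: H1.
  - by move=> i i' /Lmem[iL _] /Lmem[iL' _]; exact: H2.
  - by rewrite expnS -[X in (X <= _)%N]muln1 leq_mul2l expn_gt0.
  - by move=> i /Lmem[_ /andP[]].
apply: (@leq_trans (8 * (size L * (2 ^ j.+1) ^ 3))%N); last first.
  by rewrite (expnD 2 3 9) -[(2 ^ 3 * _ * _)%N]mulnA leq_mul2l.
rewrite mulnCA -sum1_size big_distrl /= big_seq [X in (_ <= X)%N]big_seq.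
apply: leq_sum => i /Lmem[_ /andP[_ /ltnW h]]; rewrite mul1n.
have -> : (8 * (2 ^ j.+1) ^ 3 = (2 ^ j.+2) ^ 3)%N by rewrite [(2 ^ j.+2)%N]expnS expnMn.
by rewrite leq_exp2r.
Qed.

End Incidences.

(** * Third moments and multiplicative energy *)

Section Grids.
Variable R : realFieldType.
Implicit Types (A B P W : seq R).

Definition grid A B := [seq (a, b) | a <- A, b <- B].

Lemma grid_uniq A B : uniq A -> uniq B -> uniq (grid A B).
Proof. by move=> uA uB; apply: allpairs_uniq => // -[? ?] [? ?] _ _ [-> ->]. Qed.

Lemma mem_grid A B p : (p \in grid A B) = (p.1 \in A) && (p.2 \in B).
Proof.
case: p => a b; apply/allpairsP/andP => [[[x y] [/= xA yB [-> ->]]] //|[aA bB]].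
by exists (a, b).
Qed.

Lemma size_grid A B : size (grid A B) = (size A * size B)%N.
Proof. exact: size_allpairs. Qed.

(** The bound assumed on the total number of incidences absorbs the linear term of
    [third_moment_nat], at the cost of doubling the constant. *)
Lemma third_moment (I : eqType) (A B : seq R) (Ls : seq I)
    (inc : I -> R * R -> bool) (J : nat) :
  uniq A -> uniq B -> uniq Ls ->
  {in Ls, forall i, {in grid A B &, forall p q, inc i p -> inc i q ->
    (p.1 < q.1) = (p.2 < q.2)}} ->
  {in Ls &, forall i j, {in grid A B &, forall p q, p != q ->
    inc i p -> inc i q -> inc j p -> inc j q -> i = j}} ->
  (0 < J)%N -> (size A < 2 ^ J)%N ->
  \sum_(i <- Ls) (count (inc i) (grid A B))%:R <= (size A * size B)%:R ^+ 2 :> R ->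
  \sum_(i <- Ls) (count (inc i) (grid A B))%:R ^+ 3 <=
     2 ^+ 13 * J%:R * (size A * size B)%:R ^+ 2 :> R.
Proof.
move=> uA uB uL H1 H2 J0 AJ S1.
have := third_moment_nat uA uB uL H1 H2 J0 AJ; rewrite -(ler_nat R) natrD !natr_sum.
rewrite (eq_bigr (fun i => (count (inc i) (grid A B))%:R ^+ 3)) => [|i _];
  last by rewrite natrX.
move=> /le_trans; apply; apply: le_trans (lerD (lexx _) S1) _.
rewrite natrM [in X in X + _]natrM !natrX [2 ^+ 13]exprS -[2 * _ * J%:R]mulrA.
have : 1 <= 2 ^+ 12 * J%:R :> R by rewrite mulr_ege1 ?exprn_ege1 ?ler1n.
have := sqr_ge0 ((size A * size B)%:R : R).
move: (2 ^+ 12 * J%:R) (_ ^+ 2) => x y y0 x1.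
nra.
Qed.

Definition rsum A B (s : R) : R := fib R (fun p : R * R => p.1 + p.2) (grid A B) s.

(** A Szemeredi-Trotter type condition in third-moment form, with the dependence on the size of [A]
    put into [D]. The arbitrary list [W] stands for the whole line. *)
Definition cubic A (D : R) := forall B W, uniq B -> uniq W ->
  \sum_(s <- W) rsum A B s ^+ 3 <= D * (size B)%:R ^+ 2.

Lemma rsum_ge0 A B s : 0 <= rsum A B s. Proof. exact: fib_ge0. Qed.

Lemma rsumE A B s : rsum A B s = \sum_(a <- A) \sum_(b <- B) (a + b == s)%:R.
Proof. by rewrite /rsum fibE big_allpairs. Qed.

Lemma rsum_mem A B s : uniq A -> rsum A B s = \sum_(b <- B) (s - b \in A)%:R.
Proof.
move=> uA; rewrite rsumE exchange_big; apply: eq_bigr => b _ /=.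
by rewrite -(sum_indic1 R (s - b) uA); apply: eq_bigr => a _; rewrite subr_eq eq_sym.
Qed.

Lemma rsum_le A B s : uniq A -> rsum A B s <= (size B)%:R.
Proof.
move=> uA; rewrite rsum_mem // -sum1_size natr_sum; apply: ler_sum => b _.
by rewrite lern1 leq_b1.
Qed.

Lemma sum_rsum_le A B W : uniq W -> 
  \sum_(s <- W) rsum A B s <= (size A)%:R * (size B)%:R.
Proof.
by move=> uW; rewrite -natrM -size_grid; exact: sum_fib1_le.
Qed.

(* A sum [s = a + b] with [x * a = d] puts the point [(x, b)] on the increasing
   curve [b = s - d / x]. If [size P * size B < size A], the curves with a
   single point dominate and the trivial bound takes over. *)
Lemma cubic_ratio A P A' (t J : nat) :
  uniq A -> uniq P -> uniq A' -> {in A, forall a, 0 < a} -> {in P, forall x, 0 < x} ->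
  {subset A' <= A} -> (0 < t)%N -> (0 < J)%N -> (size P < 2 ^ J)%N ->
  {in A', forall a, (t <= count (fun x => (x * a)%R \in A) P)%N} ->
  cubic A' (2 ^+ 13 * J%:R * (size A)%:R ^+ 2 * (size P)%:R ^+ 2 / t%:R ^+ 3).
Proof.
move=> uA uP uA' A0 P0 A'A t0 J0 PJ deg B W uB uW.
have t3 : 0 < t%:R ^+ 3 :> R by rewrite exprn_gt0 // ltr0n.
rewrite -(ler_pM2l t3) mulrA [_ * (_ / _)]mulrC divfK ?gt_eqF //.
case: A' uA' A'A deg => [|a0 A0'].
  move=> _ _ _; rewrite big1 ?mulr0 => [|s _]; last by rewrite rsumE big_nil expr0n.
  by rewrite !mulr_ge0 ?exprn_ge0.
set A' := a0 :: A0' => uA' A'A deg.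
have tP : (t <= size P)%N.
  by apply: leq_trans (deg a0 _) (count_size _ _); rewrite inE eqxx.
have mn : (size A' <= size A)%N by apply: uniq_leq_size.
clearbody A'.
have J1 : 1 <= J%:R :> R by rewrite ler1n.
have [nPB|nPB] := leqP (size A) (size P * size B); last first.
  have h1 : \sum_(s <- W) rsum A' B s ^+ 3 <= (size B)%:R ^+ 2 * ((size A')%:R * (size B)%:R).
    apply: le_trans (ler_wpM2l (exprn_ge0 _ (ler0n _ _)) (sum_rsum_le A' B uW)).
    rewrite mulr_sumr; apply: ler_sum => s _; rewrite exprSr.
    by apply: ler_wpM2r; rewrite ?rsum_ge0 // ler_sqr ?nnegrE ?rsum_ge0 ?rsum_le.
  apply: le_trans (ler_wpM2l (ltW t3) h1) _.
  have h2 : (t ^ 3 * (size A' * size B) <= size A ^ 2 * size P ^ 2)%N.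
    apply: (@leq_trans (size P ^ 3 * (size A * size B))%N).
      by apply: leq_mul; [rewrite leq_exp2r|rewrite leq_mul2r mn orbT].
    have -> : (size P ^ 3 * (size A * size B) =
      size A * size P ^ 2 * (size P * size B))%N by ring.
    have -> : (size A ^ 2 * size P ^ 2 = size A * size P ^ 2 * size A)%N by ring.
    by rewrite leq_mul2l (ltnW nPB) orbT.
  move: h2; rewrite -(ler_nat R) !(natrX, natrM).
  set x := (size A)%:R; set y := (size P)%:R; set z := (size B)%:R; set w := (size A')%:R.
  move=> h2.
  have -> : t%:R ^+ 3 * (z ^+ 2 * (w * z)) = z ^+ 2 * (t%:R ^+ 3 * (w * z)) by ring.
  have -> : 2 ^+ 13 * J%:R * x ^+ 2 * y ^+ 2 * z ^+ 2 =
            z ^+ 2 * (2 ^+ 13 * J%:R * (x ^+ 2 * y ^+ 2)) by ring.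
  apply: ler_wpM2l; first exact: sqr_ge0.
  apply: le_trans h2 _; rewrite ler_peMl ?mulr_ge0 ?sqr_ge0 //; lra.
pose inc (i : R * R) (p : R * R) := p.2 + i.2 / p.1 == i.1.
pose Ls := grid W A.
(* Each representation [s = a + b] is seen at least [t] times: every [x] in [P] with [d = x * a] in
   [A] puts [(x, b)] on the curve of [(s, d)]. *)
have key s : t%:R * rsum A' B s <= \sum_(d <- A) (count (inc (s, d)) (grid P B))%:R.
  have -> : \sum_(d <- A) (count (inc (s, d)) (grid P B))%:R =
      \sum_(b <- B) \sum_(x <- P) \sum_(d <- A) (b + d / x == s)%:R :> R.
    transitivity (\sum_(x <- P) \sum_(d <- A) \sum_(b <- B) (b + d / x == s)%:R : R).
      rewrite [RHS]exchange_big; apply: eq_bigr => d _.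
      rewrite -[LHS]/(fib R (fun p => p.2 + d / p.1) (grid P B) s) fibE.
      exact: big_allpairs.
    by rewrite [RHS]exchange_big; apply: eq_bigr => x _; exact: exchange_big.
  rewrite rsum_mem // mulr_sumr; apply: ler_sum => b _.
  have [sbA|_] := boolP (s - b \in A'); last first.
    by rewrite mulr0 sumr_ge0 // => x _; rewrite sumr_ge0.
  rewrite mulr1; have := deg _ sbA; rewrite -(ler_nat R) => /le_trans; apply.
  rewrite -sum1_count natr_sum big_mkcond /= big_seq [leRHS]big_seq.
  apply: ler_sum => x xP; have x0 := P0 x xP.
  rewrite (_ : \sum_(d <- A) _ = (x * (s - b) \in A)%:R); first by case: (_ \in _).
  rewrite -(sum_indic1 R _ uA); apply: eq_bigr => d _; congr (_%:R); congr nat_of_bool.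
  apply/eqP/eqP => <-; last by rewrite [x * _]mulrC mulfK ?lt0r_neq0 // addrC subrK.
  by rewrite addrAC subrr add0r mulrC divfK ?lt0r_neq0.
have tri : \sum_(i <- Ls) (count (inc i) (grid P B))%:R ^+ 3 <=
     2 ^+ 13 * J%:R * (size P * size B)%:R ^+ 2 :> R.
  apply: third_moment => //; first exact: grid_uniq.
  - case=> s d; rewrite mem_grid /= => /andP[_ /A0 d0] [x b] [x' b'].
    rewrite !mem_grid /= => /andP[/P0 x0 _] /andP[/P0 x'0 _].
    rewrite /inc /= => /eqP e /eqP e'.
    rewrite -(ltf_pV2 x'0 x0) -(ltr_pM2l d0).
    by apply/idP/idP => h; lra.
  - case=> s d [s' d'] _ _ [x b] [x' b'].
    rewrite !mem_grid /= => /andP[/P0 x0 _] /andP[/P0 x'0 _] ne.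
    rewrite /inc /= => /eqP e1 /eqP e2 /eqP e3 /eqP e4.
    have xx : x^-1 != x'^-1.
      apply: contraNneq ne => xx; have := invr_inj xx => xx'; rewrite xx' in e1 *.
      by apply/eqP; congr (_, _); lra.
    have /eqP : (d - d') * (x^-1 - x'^-1) = 0 by lra.
    rewrite mulf_eq0 [_ - _^-1 == 0]subr_eq0 (negPf xx) orbF subr_eq0 => /eqP dd.
    by rewrite dd in e1 *; congr (_, _); lra.
  (* For fixed [d] each grid point lies on at most one curve, so there are at most
     [size A * size P * size B] incidences; here [size A <= size P * size B] enters. *)
  - have -> : \sum_(i <- Ls) (count (inc i) (grid P B))%:R =
        \sum_(d <- A) \sum_(s <- W) fib R (fun p => p.2 + d / p.1) (grid P B) s.
      by rewrite big_allpairs exchange_big.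
    apply: (@le_trans _ _ (\sum_(d <- A) (size (grid P B))%:R)).
      by apply: ler_sum => d _; exact: sum_fib1_le.
    rewrite big_const_seq count_predT iter_addr_0 size_grid -[leLHS]mulr_natr.
    by rewrite -natrM -natrX ler_nat -mulnn leq_mul2l nPB orbT.
(* Cubing [key] and applying Hölder over [d] produces the factor [size A ^ 2] of the constant. *)
rewrite mulr_sumr; apply: (@le_trans _ _ (\sum_(s <- W) (size A)%:R ^+ 2 *
    \sum_(d <- A) (count (inc (s, d)) (grid P B))%:R ^+ 3)).
  apply: ler_sum => s _; rewrite -exprMn.
  apply: le_trans (sum_cube _ _); last by move=> d; exact: ler0n.
  by rewrite lerXn2r ?nnegrE ?mulr_ge0 ?rsum_ge0 // sumr_ge0.
rewrite -mulr_sumr; have := ler_wpM2l (sqr_ge0 (size A)%:R) tri.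
rewrite big_allpairs /= => /le_trans; apply; rewrite natrM.
by rewrite le_eqVlt; apply/orP; left; apply/eqP; ring.
Qed.



(** * Ratios and multiplicative energy *)

Definition ratios A := undup [seq p.1 / p.2 | p <- grid A A].

Definition rdiv A (x : R) : R := fib R (fun p : R * R => p.1 / p.2) (grid A A) x.

Lemma mem_ratios A : {in grid A A, forall p, p.1 / p.2 \in ratios A}.
Proof. by move=> p pA; rewrite mem_undup (map_f (fun p : R * R => p.1 / p.2)). Qed.

Lemma ratios_gt0 A x : {in A, forall a, 0 < a} -> x \in ratios A -> 0 < x.
Proof.
move=> A0; rewrite mem_undup => /mapP[p]; rewrite mem_grid => /andP[p1 p2] ->.
by rewrite divr_gt0 ?A0.
Qed.

(** The additive energy of [A] and its dilate [x A]. *)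
Definition dilate_energy A (x : R) : R :=
  coll R (fun p : R * R => p.2 - x * p.1) (grid A A)
         (fun p : R * R => p.2 - x * p.1) (grid A A).

Lemma coll_ge0 (I I' T : eqType) (f : I -> T) X (g : I' -> T) Y : 0 <= coll R f X g Y.
Proof. by rewrite sumr_ge0 // => i _; rewrite sumr_ge0. Qed.

(** The two maps are opposite to each other, hence have the same energy, and Cauchy-Schwarz
    applies. *)
Lemma coll_sum_le A x :
  coll R (fun p : R * R => p.2 - x * p.1) (grid A A)
         (fun p : R * R => x * p.1 - p.2) (grid A A) <= dilate_energy A x.
Proof.
have := coll_cs R (fun p : R * R => p.2 - x * p.1) (grid A A)
                  (fun p : R * R => x * p.1 - p.2) (grid A A).
have -> : coll R (fun p : R * R => x * p.1 - p.2) (grid A A)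
                 (fun p : R * R => x * p.1 - p.2) (grid A A) = dilate_energy A x.
  apply: eq_bigr => p _; apply: eq_bigr => q _; congr (_%:R); congr nat_of_bool.
  by rewrite -eqr_opp !opprB.
by rewrite -expr2 ler_sqr // nnegrE coll_ge0.
Qed.

(* Writing [a (b + c) = a' (b' + c')] as [b' - x b = x c - c'] with [x = a / a']
   turns each ratio [x] into a slope. *)
Lemma sum_dilate_energy_ge A W : uniq A -> {in A, forall a, 0 < a} -> uniq W ->
  {in A & &, forall a b c, a * (b + c) \in W} ->
  (size A)%:R ^+ 6 <= (size W)%:R * \sum_(x <- ratios A) rdiv A x * dilate_energy A x.
Proof.
move=> uA A0 uW AW.
pose X := [seq (a, q) | a <- A, q <- grid A A].
pose f (p : R * (R * R)) := p.1 * (p.2.1 + p.2.2).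
have fW : {in X, forall p, f p \in W}.
  move=> p /allpairsP[[a [b c]] [/= aA]]; rewrite mem_grid /= => /andP[bA cA] ->.
  exact: AW.
have := size_sq_le_coll R uW fW.
rewrite size_allpairs size_grid -natrX.
have -> : ((size A * (size A * size A)) ^ 2 = size A ^ 6)%N by ring.
rewrite natrX => /le_trans; apply; apply: ler_wpM2l => //.
rewrite -(sum_fib (dilate_energy A) (undup_uniq _) (@mem_ratios A)) big_allpairs.
rewrite /coll big_allpairs /= big_seq [leRHS]big_seq; apply: ler_sum => a aA.
apply: (@le_trans _ _ (\sum_(p <- grid A A) \sum_(a' <- A) \sum_(q <- grid A A)
    (f (a, p) == f (a', q))%:R)).
  by rewrite le_eqVlt; apply/orP; left; apply/eqP/eq_bigr => p _; rewrite big_allpairs.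
rewrite exchange_big /= big_seq [leRHS]big_seq; apply: ler_sum => a' a'A.
have a0 : a' != 0 by rewrite lt0r_neq0 ?A0.
apply: le_trans (coll_sum_le A (a / a')).
rewrite /coll !big_allpairs /=.
rewrite le_eqVlt; apply/orP; left; apply/eqP.
transitivity (\sum_(b <- A) \sum_(c <- A) \sum_(b' <- A) \sum_(c' <- A)
    (b' - a / a' * b == a / a' * c - c')%:R : R).
  apply: eq_bigr => b _; apply: eq_bigr => c _; rewrite big_allpairs.
  apply: eq_bigr => b' _; apply: eq_bigr => c' _; congr (_%:R); congr nat_of_bool.
  rewrite /f /= -(inj_eq (mulfI a0) (_ - _)) eq_sym.
  have -> : a' * (b' - a / a' * b) = a' * b' - a * b by field.
  have -> : a' * (a / a' * c - c') = a * c - a' * c' by field.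
  by rewrite !mulrDr; apply/eqP/eqP => h; lra.
apply: eq_bigr => b _.
transitivity (\sum_(b' <- A) \sum_(c <- A) \sum_(c' <- A)
    (b' - a / a' * b == a / a' * c - c')%:R : R).
  by rewrite exchange_big.
by apply: eq_bigr => b' _; rewrite big_allpairs.
Qed.

(** The lines [b' = x b + k] with [x] a ratio have positive slope, so they are increasing curves in
    [A * A], and [r (x, k)] counts their points. Cauchy-Schwarz splits the sum of [rdiv * r^2] into
    that of [rdiv^2 * r], which is the multiplicative energy times [size A ^ 2], and the third
    moment of [r]. *)
Lemma mult_energy_bound A W (J : nat) :
  uniq A -> {in A, forall a, 0 < a} -> uniq W ->
  {in A & &, forall a b c, a * (b + c) \in W} ->
  (0 < J)%N -> (size A < 2 ^ J)%N ->
  (size A)%:R ^+ 12 <= 2 ^+ 13 * J%:R * (size A)%:R ^+ 6 * (size W)%:R ^+ 2 *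
                     \sum_(x <- ratios A) rdiv A x ^+ 2.
Proof.
move=> uA A0 uW AW J0 AJ; set E := \sum_(x <- ratios A) rdiv A x ^+ 2.
pose r (i : R * R) := fib R (fun p : R * R => p.2 - i.1 * p.1) (grid A A) i.2.
pose K := undup [seq q.2 - x * q.1 | x <- ratios A, q <- grid A A].
have uK : uniq K by exact: undup_uniq.
have uL : uniq (ratios A) by exact: undup_uniq.
have memK x : x \in ratios A -> {in grid A A, forall q, q.2 - x * q.1 \in K}.
  move=> xL q qA; rewrite mem_undup; apply/allpairsP; exists (x, q); split=> //.
have sumr x : x \in ratios A -> \sum_(k <- K) r (x, k) = (size A)%:R ^+ 2.
  by move=> xL; rewrite (sum_fib1 R uK (memK x xL)) size_grid natrM expr2.
have dE : \sum_(x <- ratios A) rdiv A x * dilate_energy A x =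
    \sum_(i <- grid (ratios A) K) rdiv A i.1 * r i ^+ 2.
  rewrite big_allpairs big_seq [RHS]big_seq; apply: eq_bigr => x xL.
  rewrite /dilate_energy (coll_fib R _ _ uK (memK x xL)) mulr_sumr.
  by apply: eq_bigr => k _; rewrite expr2.
have cs : (\sum_(i <- grid (ratios A) K) rdiv A i.1 * r i ^+ 2) ^+ 2 <=
   (\sum_(i <- grid (ratios A) K) rdiv A i.1 ^+ 2 * r i) *
   (\sum_(i <- grid (ratios A) K) r i ^+ 3).
  apply: cauchy_schwarz => i; rewrite ?mulr_ge0 ?sqr_ge0 ?exprn_ge0 ?fib_ge0 //.
  by rewrite le_eqVlt; apply/orP; left; apply/eqP; ring.
have e1 : \sum_(i <- grid (ratios A) K) rdiv A i.1 ^+ 2 * r i = E * (size A)%:R ^+ 2.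
  rewrite big_allpairs mulr_suml big_seq [RHS]big_seq; apply: eq_bigr => x xL /=.
  by rewrite -mulr_sumr sumr.
have e3 : \sum_(i <- grid (ratios A) K) r i ^+ 3 <=
    2 ^+ 13 * J%:R * (size A * size A)%:R ^+ 2.
  apply: (@third_moment _ _ _ _ (fun i p => p.2 - i.1 * p.1 == i.2)) => //.
  - exact: grid_uniq.
  - case=> x k; rewrite mem_grid /= => /andP[/(ratios_gt0 A0) x0 _] p q _ _.
    move=> /eqP e /eqP e'; rewrite -(ltr_pM2l x0); by apply/idP/idP => h; lra.
  - case=> x k [x' k'] _ _ [a b] [a' b'] _ _ ne /= /eqP h1 /eqP h2 /eqP h3 /eqP h4.
    have aa : a != a'.
      by apply: contraNneq ne => aa; rewrite aa in h1 *; apply/eqP; congr (_, _); lra.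
    have /eqP : (x - x') * (a - a') = 0 by lra.
    rewrite mulf_eq0 [a - _ == 0]subr_eq0 (negPf aa) orbF subr_eq0 => /eqP xx.
    by rewrite xx in h1 *; congr (_, _); lra.
  (* Each of the at most [size A ^ 2] slopes partitions the grid, so there are at most [size A ^ 4]
     incidences. *)
  - rewrite big_allpairs.
    apply: (@le_trans _ _ (\sum_(x <- ratios A) (size A)%:R ^+ 2)).
      by rewrite big_seq [leRHS]big_seq; apply: ler_sum => x xL; rewrite -(sumr x).
    rewrite big_const_seq count_predT iter_addr_0 -[leLHS]mulr_natr natrM -expr2.
    rewrite [leRHS]expr2; apply: ler_wpM2l; first exact: sqr_ge0.
    by rewrite -natrX ler_nat (leq_trans (size_undup _)) // size_map size_grid.
have := sum_dilate_energy_ge uA A0 uW AW; rewrite dE.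
move: cs; rewrite e1; move: (\sum_(i <- grid _ K) _ * _) => M cs hM.
have M2 : M ^+ 2 <= E * (size A)%:R ^+ 2 * (2 ^+ 13 * J%:R * (size A * size A)%:R ^+ 2).
  apply: le_trans cs _; apply: ler_wpM2l e3.
  by rewrite mulr_ge0 ?sqr_ge0 ?sumr_ge0 // => x _; exact: sqr_ge0.
have -> : (size A)%:R ^+ 12 = ((size A)%:R ^+ 6) ^+ 2 :> R by ring.
apply: (@le_trans _ _ (((size W)%:R * M) ^+ 2)).
  rewrite lerXn2r ?nnegrE ?exprn_ge0 //.
  by apply: le_trans hM; exact: exprn_ge0.
rewrite exprMn; apply: le_trans (ler_wpM2l (sqr_ge0 _) M2) _.
by rewrite natrM le_eqVlt; apply/orP; left; apply/eqP; ring.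
Qed.

End Grids.

(** * Popular differences and popular sums *)

Section Additive.
Variable R : realFieldType.
Implicit Types (A B C P S W : seq R) (D : R).

Definition rdif A B (s : R) : R := fib R (fun p : R * R => p.1 - p.2) (grid A B) s.

Definition denergy A B : R :=
  coll R (fun p : R * R => p.1 - p.2) (grid A B) (fun p : R * R => p.1 - p.2) (grid A B).

Definition diffs A B := undup [seq p.1 - p.2 | p <- grid A B].

Lemma mem_diffs A B : {in grid A B, forall p, p.1 - p.2 \in diffs A B}.
Proof. by move=> p pA; rewrite mem_undup (map_f (fun p : R * R => p.1 - p.2)). Qed.

Lemma rdif_ge0 A B s : 0 <= rdif A B s. Proof. exact: fib_ge0. Qed.

Lemma rdifE A B s : rdif A B s = rsum A [seq - b | b <- B] s.
Proof.
by rewrite rsumE /rdif fibE big_allpairs; apply: eq_bigr => a _; rewrite big_map.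
Qed.

Lemma cubic_sub A B D : uniq A -> uniq B -> {subset B <= A} -> cubic A D -> cubic B D.
Proof.
move=> uA uB BA cA C W uC uW; apply: le_trans (cA C W uC uW); apply: ler_sum => s _.
rewrite lerXn2r ?nnegrE ?rsum_ge0 // !rsum_mem //; apply: ler_sum => c _.
by have := BA (s - c); case: (_ \in B) => // ->.
Qed.

(** [cubic] quantifies over every second set, hence covers [-B] too. *)
Lemma cubic_dif A B D W : cubic A D -> uniq B -> uniq W ->
  \sum_(s <- W) rdif A B s ^+ 3 <= D * (size B)%:R ^+ 2.
Proof.
move=> cA uB uW; under eq_bigr do rewrite rdifE.
rewrite -(size_map -%R); apply: cA => //.
by rewrite map_inj_uniq //; exact: oppr_inj.
Qed.

Lemma denergy_rdif A B : denergy A B = \sum_(s <- diffs A B) rdif A B s ^+ 2.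
Proof.
rewrite /denergy (coll_fib R _ _ (undup_uniq _) (@mem_diffs A B)).
by apply: eq_bigr => s _; rewrite expr2.
Qed.

(** Cauchy-Schwarz bounds the second moment by the first, which is [size A * size B], and the third,
    which [cubic] controls. *)
Lemma denergy_cubic A B D : cubic A D -> uniq B ->
  denergy A B ^+ 2 <= D * (size A)%:R * (size B)%:R ^+ 3.
Proof.
move=> cA uB; rewrite denergy_rdif.
apply: (@le_trans _ _ ((\sum_(s <- diffs A B) rdif A B s) *
    (\sum_(s <- diffs A B) rdif A B s ^+ 3))).
  apply: cauchy_schwarz => s; rewrite ?exprn_ge0 ?rdif_ge0 //.
  by rewrite le_eqVlt; apply/orP; left; apply/eqP; ring.
rewrite (sum_fib1 R (undup_uniq _) (@mem_diffs A B)) size_grid natrM.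
have -> : D * (size A)%:R * (size B)%:R ^+ 3 =
  (size A)%:R * (size B)%:R * (D * (size B)%:R ^+ 2) by ring.
by apply: ler_wpM2l; [rewrite mulr_ge0|apply: cubic_dif; rewrite ?undup_uniq].
Qed.

(** Cauchy-Schwarz counts solutions of [a + b = c + d]; rewriting them as [a - c = d - b] gives the
    energy of differences. *)
Lemma denergy_ge A S : uniq S -> {in A &, forall a b, a + b \in S} ->
  (size A)%:R ^+ 4 <= (size S)%:R * denergy A A.
Proof.
move=> uS AS; have sS : {in grid A A, forall p, p.1 + p.2 \in S}.
  by move=> p; rewrite mem_grid => /andP[]; exact: AS.
have := size_sq_le_coll R uS sS; rewrite size_grid natrM -expr2 -exprM.
move=> /le_trans; apply; apply: ler_wpM2l => //.
rewrite /denergy /coll !big_allpairs le_eqVlt; apply/orP; left; apply/eqP.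
apply: eq_bigr => a _.
transitivity (\sum_(b <- A) \sum_(c <- A) \sum_(d <- A) (a + b == c + d)%:R : R).
  by apply: eq_bigr => b _; rewrite big_allpairs.
transitivity (\sum_(c <- A) \sum_(d <- A) \sum_(b <- A) (a - c == d - b)%:R : R).
  rewrite exchange_big; apply: eq_bigr => c _; rewrite exchange_big.
  apply: eq_bigr => d _; apply: eq_bigr => b _; congr (_%:R); congr nat_of_bool.
  by apply/eqP/eqP => h; lra.
by apply: eq_bigr => c _; rewrite big_allpairs.
Qed.

Lemma rdif_lt A B s J : uniq A -> (size B < 2 ^ J)%N ->
  (count (fun p : R * R => p.1 - p.2 == s)%R (grid A B) < 2 ^ J)%N.
Proof.
move=> uA; apply: leq_ltn_trans; rewrite -(ler_nat R) -[leLHS]/(rdif A B s).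
by rewrite rdifE -(size_map -%R B); exact: rsum_le.
Qed.

(** [P] is the dyadic class of differences that dominates the energy; it is nonempty because the
    energy is positive. *)
Lemma popular_diffs A D J : uniq A -> (0 < size A)%N -> (0 < J)%N ->
  (size A < 2 ^ J)%N -> cubic A D ->
  exists (P : seq R) (j : nat), [/\ uniq P,
    denergy A A <= 4 * J%:R * (size P)%:R * (2 ^+ j) ^+ 2,
    (size P)%:R * (2 ^+ j) ^+ 3 <= D * (size A)%:R ^+ 2,
    {in P, forall x, 2 ^+ j <= rdif A A x} & (0 < size P)%N].
Proof.
move=> uA A0 J0 AJ cA.
pose r x := count (fun p : R * R => p.1 - p.2 == x) (grid A A).
have rJ : {in diffs A A, forall x, (r x < 2 ^ J)%N} by move=> x _; exact: rdif_lt.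
have [j hj] := dyadic_level R J0 (ltn0Sn 1) rJ.
set P := [seq x <- diffs A A | _] in hj.
have uP : uniq P by rewrite filter_uniq // undup_uniq.
have Pr x : x \in P -> 2 ^+ j <= rdif A A x.
  by rewrite mem_filter => /andP[/andP[h _] _]; rewrite -natrX ler_nat.
have EP : denergy A A <= 4 * J%:R * (size P)%:R * (2 ^+ j) ^+ 2.
  rewrite denergy_rdif; apply: le_trans hj _.
  by rewrite [2 ^+ j.+1]exprS le_eqVlt; apply/orP; left; apply/eqP; ring.
exists P, j; split=> //.
- apply: le_trans (cubic_dif cA uA uP).
  rewrite -sum1_size natr_sum mulr_suml big_seq [leRHS]big_seq.
  apply: ler_sum => x /Pr h.
  by rewrite mul1r lerXn2r ?nnegrE ?rdif_ge0 ?exprn_ge0.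
- rewrite lt0n; apply: contraTneq EP => ->; rewrite mulr0 mul0r -ltNge.
  have uS : uniq (undup [seq p.1 + p.2 | p <- grid A A]) by exact: undup_uniq.
  have := denergy_ge uS; move=> /(_ A) h; rewrite lt_neqAle coll_ge0 andbT eq_sym.
  apply: contraTneq A0 => E0; rewrite -eqn0Ngt -(@pnatr_eq0 R).
  have : (size A)%:R ^+ 4 <= 0 :> R.
    rewrite -[leRHS](mulr0 (size (undup [seq p.1 + p.2 | p <- grid A A]))%:R) -E0.
    apply: h => a b aA bA; rewrite mem_undup.
    by apply/mapP; exists (a, b); rewrite ?mem_grid ?aA.
  by rewrite real_exprn_even_le0 // ger0_real.
Qed.

(** Serves twice: for degrees in the graph of popular differences and in that of popular ratios. *)
Lemma popular_degrees (A : seq R) (deg : R -> nat) (J : nat) (T : R) :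
  uniq A -> (0 < J)%N -> {in A, forall a, (deg a < 2 ^ J)%N} ->
  0 < T -> T <= \sum_(a <- A) (deg a)%:R ->
  exists (B : seq R) (g : nat), [/\ uniq B, {subset B <= A},
    {in B, forall b, (2 ^ g <= deg b)%N}, (0 < size B)%N &
    T <= 2 * J%:R * 2 ^+ g * (size B)%:R].
Proof.
move=> uA J0 dJ T0 hT; have [g hg] := dyadic_level R J0 (ltn0Sn 0) dJ.
set B := [seq x <- A | _] in hg.
have hB : T <= 2 * J%:R * 2 ^+ g * (size B)%:R.
  apply: le_trans hT _; rewrite (eq_bigr (fun a => (deg a)%:R ^+ 1)) //.
  apply: le_trans hg _.
  by rewrite expr1 exprS le_eqVlt; apply/orP; left; apply/eqP; ring.
exists B, g; split=> //.
- exact: filter_uniq.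
- by move=> x; rewrite mem_filter => /andP[].
- by move=> x; rewrite mem_filter => /andP[/andP[]].
- by rewrite lt0n; apply: contraTneq hB => ->; rewrite mulr0 -ltNge.
Qed.

(* Translation identifies triples [(a, b, c)] and [(a - t, b + t, c + t)], whose
   common invariant is [(a + b, a + c)]. The two coordinates differ by [b - c],
   so few pairs [targets] occur if [b - c] and [a + b] are popular. *)
Section Triples.
Variables (A B P S : seq R) (D : R) (g : nat).
Hypotheses (uA : uniq A) (uB : uniq B) (uP : uniq P) (uS : uniq S).
Hypotheses (BA : {subset B <= A}) (cA : cubic A D).
Hypothesis AS : {in A &, forall a b, a + b \in S}.
Hypothesis degB : {in B, forall b, (g <= count (fun c => (b - c)%R \in P) A)%N}.

Let m : R := (size A)%:R.
Let b_ : R := (size B)%:R.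
Let s_ : R := (size S)%:R.
Let popular y := m * b_ <= 2 * s_ * rsum A B y.
Let triples := [seq q <- [seq (a, p) | a <- A, p <- grid B A] |
  (q.2.1 - q.2.2 \in P) && popular (q.1 + q.2.1)].
Let sums (q : R * (R * R)) := (q.1 + q.2.1, q.1 + q.2.2).
Let targets := [seq q <- grid S S | (q.1 - q.2 \in P) && popular q.1].

Lemma sums_in : {in grid A B, forall p, p.1 + p.2 \in S}.
Proof. by move=> p; rewrite mem_grid => /andP[p1 /BA p2]; exact: AS. Qed.

(** Sums with less than half the average number [m b / s] of representations account for at most
    half of all pairs. *)
Lemma sums_popular : m * b_ <= 2 * \sum_(p <- grid A B) (popular (p.1 + p.2))%:R.
Proof.
have tot : \sum_(y <- S) rsum A B y = m * b_.
  by rewrite (sum_fib1 R uS sums_in) size_grid natrM.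
rewrite (sum_fib (fun y => (popular y)%:R) uS sums_in).
have [s0|s0] := posnP (size S).
  by rewrite -tot (size0nil s0) !big_nil mulr0.
have sp : 0 < s_ by rewrite ltr0n.
have h : 2 * s_ * \sum_(y <- S) rsum A B y * (~~ popular y)%:R <= s_ * (m * b_).
  rewrite {2}/s_ -sum1_size natr_sum mulr_sumr mulr_suml; apply: ler_sum => y _.
  rewrite mul1r; have [_|] := boolP (popular y) => /=.
    by rewrite mulr0n !mulr0 mulr_ge0.
  by rewrite /popular -ltNge mulr1n mulr1 => /ltW.
have e : \sum_(y <- S) rsum A B y * (~~ popular y)%:R +
         \sum_(y <- S) rsum A B y * (popular y)%:R = m * b_.
  rewrite -tot -big_split; apply: eq_bigr => y _ /=.
  by case: (popular y); rewrite /= ?mulr1n ?mulr0n !(mulr0, mulr1, add0r, addr0).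
move: h; rewrite -mulrA mulrCA (ler_pM2l sp); rewrite -{}e.
rewrite -/(rsum A B); move: (\sum_(y <- S) _) (\sum_(y <- S) _) => u v; lra.
Qed.

Lemma size_triples_ge : m * b_ * g%:R <= 2 * (size triples)%:R.
Proof.
apply: le_trans (ler_wpM2r (ler0n _ g) sums_popular) _.
rewrite -mulrA; apply: ler_wpM2l => //.
have -> : (size triples)%:R = \sum_(a <- A) \sum_(b <- B) \sum_(c <- A)
    ((b - c \in P) && popular (a + b))%:R :> R.
  rewrite -sum1_size natr_sum big_filter big_mkcond big_allpairs.
  apply: eq_bigr => a _; rewrite big_allpairs; apply: eq_bigr => b _.
  by apply: eq_bigr => c _ /=; case: (_ && _).
rewrite big_allpairs mulr_suml; apply: ler_sum => a _; rewrite mulr_suml.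
rewrite big_seq [leRHS]big_seq; apply: ler_sum => b bB.
have [pop|_] := boolP (popular (a + b)); last first.
  by rewrite mul0r sumr_ge0 // => c _; rewrite andbF.
rewrite mul1r; have := degB bB; rewrite -(ler_nat R) => /le_trans; apply.
rewrite -sum1_count natr_sum big_mkcond; apply: ler_sum => c _.
by case: (b - c \in P).
Qed.

Lemma triples_targets : {in triples, forall q, sums q \in targets}.
Proof.
move=> q; rewrite mem_filter => /andP[/andP[qP qpop] /allpairsP[[a [b c]] [/= aA]]].
rewrite mem_grid /= => /andP[bB cA'] e; rewrite e /= in qP qpop *.
rewrite mem_filter mem_grid /= qpop !AS ?(BA bB) // andbT.
have -> : a + b - (a + c) = b - c by ring.
by rewrite qP.
Qed.

Lemma ler_sum_filter (I : Type) (X : seq I) (c : pred I) (F : I -> R) :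
  (forall i, 0 <= F i) -> \sum_(i <- seq.filter c X) F i <= \sum_(i <- X) F i.
Proof.
by move=> F0; rewrite big_filter big_mkcond; apply: ler_sum => i _; case: ifP.
Qed.

(** Colliding triples satisfy [a - a' = b' - b = c' - c]. Summing over this common difference [t]
    gives the sum [T] of [r_{A-A}(t)^2 r_{B-B}(t)], which Hölder and [cubic] bound. *)
Lemma coll_triples_le : coll R sums triples sums triples ^+ 3 <=
  D ^+ 3 * m ^+ 4 * b_ ^+ 2.
Proof.
pose T := \sum_(t <- diffs A A) rdif A A t ^+ 2 * rdif B B t.
have uD : uniq (diffs A A) by exact: undup_uniq.
have cB : cubic B D := cubic_sub uA uB BA cA.
have T0 : 0 <= T by rewrite sumr_ge0 // => t _; rewrite mulr_ge0 ?exprn_ge0 ?rdif_ge0.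
have T3 : T ^+ 3 <= D ^+ 3 * m ^+ 4 * b_ ^+ 2.
  have -> : D ^+ 3 * m ^+ 4 * b_ ^+ 2 = (D * m ^+ 2) ^+ 2 * (D * b_ ^+ 2) by ring.
  apply: le_trans (holder21 _ _ _) _; try by move=> t; exact: rdif_ge0.
  have h1 := cubic_dif cA uA uD; have h2 := cubic_dif cB uB uD.
  have p1 : 0 <= \sum_(t <- diffs A A) rdif A A t ^+ 3.
    by rewrite sumr_ge0 // => t _; rewrite exprn_ge0 ?rdif_ge0.
  have p2 : 0 <= \sum_(t <- diffs A A) rdif B B t ^+ 3.
    by rewrite sumr_ge0 // => t _; rewrite exprn_ge0 ?rdif_ge0.
  apply: ler_pM => //; first exact: exprn_ge0.
  by rewrite lerXn2r ?nnegrE //; exact: le_trans h1.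
apply: le_trans T3; rewrite lerXn2r ?nnegrE ?coll_ge0 //.
rewrite /coll; apply: le_trans (ler_sum_filter _ _ _) _.
  by move=> q; rewrite sumr_ge0.
apply: (@le_trans _ _ (\sum_(q <- [seq (a, p) | a <- A, p <- grid B A])
    \sum_(q' <- [seq (a, p) | a <- A, p <- grid B A]) (sums q == sums q')%:R)).
  by apply: ler_sum => q _; exact: ler_sum_filter.
have -> : T = \sum_(p <- grid A A) rdif A A (p.1 - p.2) * rdif B B (p.1 - p.2).
  rewrite (sum_fib (fun t => rdif A A t * rdif B B t) uD (@mem_diffs A A)).
  by apply: eq_bigr => t _; rewrite expr2 mulrA.
rewrite !big_allpairs le_eqVlt; apply/orP; left; apply/eqP.
apply: eq_bigr => a _.
transitivity (\sum_(p <- grid B A) \sum_(a' <- A) \sum_(p' <- grid B A)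
   (sums (a, p) == sums (a', p'))%:R : R).
  by apply: eq_bigr => p _; rewrite big_allpairs.
rewrite exchange_big; apply: eq_bigr => a' _ /=.
transitivity (\sum_(b <- B) \sum_(c <- A) \sum_(b' <- B) \sum_(c' <- A)
   ((b' - b == a - a')%:R * (c' - c == a - a')%:R) : R).
  rewrite big_allpairs; apply: eq_bigr => b _; apply: eq_bigr => c _.
  rewrite big_allpairs; apply: eq_bigr => b' _; apply: eq_bigr => c' _ /=.
  rewrite /sums /= xpair_eqE -mulnb natrM.
  by congr (_%:R * _%:R); congr nat_of_bool; apply/eqP/eqP => h; lra.
rewrite /rdif !fibE !big_allpairs mulrC.
rewrite [X in _ = X * _]exchange_big [X in _ = _ * X]exchange_big big_distrlr /=.
by apply: eq_bigr => b _; apply: eq_bigr => c _; rewrite big_distrlr.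
Qed.

(** A popular [y] has at least [m b / (2 s)] representations [a + b], so the targets are bounded
    through the number [Z] of solutions of [a - x = z - b] with [x] in [P] and [z] in [S].
    Cauchy-Schwarz separates the sides into two energies, and [denergy_cubic] applies to each. *)
Lemma size_targets_le : ((size targets)%:R * m * b_) ^+ 4 <=
  16 * s_ ^+ 7 * D ^+ 2 * m * b_ * (size P)%:R ^+ 3.
Proof.
pose f (p : R * R) := p.1 - p.2; pose f' (p : R * R) := p.2 - p.1.
pose Z := coll R f (grid A P) f' (grid B S).
have Z0 : 0 <= Z by exact: coll_ge0.
have cB : cubic B D := cubic_sub uA uB BA cA.
have Z2 : Z ^+ 2 <= denergy A P * denergy B S.
  have -> : denergy B S = coll R f' (grid B S) f' (grid B S).
    apply: eq_bigr => p _; apply: eq_bigr => q _; congr (_%:R); congr nat_of_bool.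
    by rewrite -eqr_opp !opprB.
  exact: coll_cs.
have Z4 : Z ^+ 4 <= (D * m * (size P)%:R ^+ 3) * (D * b_ * s_ ^+ 3).
  have -> : Z ^+ 4 = (Z ^+ 2) ^+ 2 by ring.
  apply: (@le_trans _ _ ((denergy A P * denergy B S) ^+ 2)).
    by rewrite lerXn2r ?nnegrE ?exprn_ge0 ?mulr_ge0 ?coll_ge0.
  by rewrite exprMn; apply: ler_pM; rewrite ?sqr_ge0 ?denergy_cubic.
have XZ : (size targets)%:R * m * b_ <= 2 * s_ * Z.
  rewrite -mulrA -sum1_size natr_sum mulr_suml.
  apply: (@le_trans _ _ (\sum_(q <- targets) 2 * s_ * rsum A B q.1)).
    rewrite big_seq [leRHS]big_seq; apply: ler_sum => q.
    by rewrite mem_filter mul1r => /andP[/andP[_]].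
  rewrite -mulr_sumr; apply: ler_wpM2l; first by rewrite mulr_ge0.
  apply: (@le_trans _ _ (\sum_(y <- S) \sum_(z <- S) rsum A B y * (y - z \in P)%:R)).
    rewrite big_filter big_mkcond big_allpairs; apply: ler_sum => y _.
    apply: ler_sum => z _ /=; case: (_ \in P) => /=; last by rewrite mulr0.
    by case: ifP => _; rewrite mulr1 ?rsum_ge0.
  rewrite exchange_big /= /Z /coll le_eqVlt; apply/orP; left; apply/eqP.
  transitivity (\sum_(z <- S) \sum_(a <- A) \sum_(b <- B) \sum_(x <- P)
      (a - x == z - b)%:R : R).
    apply: eq_bigr => z _; rewrite -(sum_fib (fun y => (y - z \in P)%:R) uS sums_in).
    rewrite big_allpairs; apply: eq_bigr => a _; apply: eq_bigr => b _ /=.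
    rewrite -(sum_indic1 R _ uP); apply: eq_bigr => x _; congr (_%:R); congr nat_of_bool.
    by apply/eqP/eqP => h; lra.
  rewrite exchange_big big_allpairs; apply: eq_bigr => a _ /=.
  transitivity (\sum_(z <- S) \sum_(x <- P) \sum_(b <- B) (a - x == z - b)%:R : R).
    by apply: eq_bigr => z _; rewrite exchange_big.
  rewrite exchange_big; apply: eq_bigr => x _ /=.
  by rewrite exchange_big big_allpairs.
have X0 : 0 <= (size targets)%:R * m * b_ by rewrite !mulr_ge0.
apply: (@le_trans _ _ ((2 * s_ * Z) ^+ 4)).
  by rewrite lerXn2r ?nnegrE // !mulr_ge0.
rewrite exprMn.
have -> : 16 * s_ ^+ 7 * D ^+ 2 * m * b_ * (size P)%:R ^+ 3 =
  (2 * s_) ^+ 4 * ((D * m * (size P)%:R ^+ 3) * (D * b_ * s_ ^+ 3)) by ring.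
by apply: ler_wpM2l Z4; rewrite exprn_ge0 // mulr_ge0.
Qed.

(** [T], [X], [Q] count triples, targets and collisions. Cauchy-Schwarz gives [T^2 <= X Q]. *)
Lemma popular_triples : (0 < size A)%N -> (0 < size B)%N -> (0 < g)%N ->
  exists T X Q : R, [/\ 0 < T, 0 < X & 0 < Q] /\
    [/\ m * b_ * g%:R <= 2 * T, T ^+ 2 <= X * Q,
        Q ^+ 3 <= D ^+ 3 * m ^+ 4 * b_ ^+ 2 &
        (X * m * b_) ^+ 4 <= 16 * s_ ^+ 7 * D ^+ 2 * m * b_ * (size P)%:R ^+ 3].
Proof.
move=> A0 B0 g0.
exists (size triples)%:R, (size targets)%:R, (coll R sums triples sums triples).
have TXQ := size_sq_le_coll R (filter_uniq _ (grid_uniq uS uS)) triples_targets.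
have T0 : 0 < (size triples)%:R :> R.
  have := size_triples_ge; rewrite -(pmulr_rgt0 _ (ltr0Sn R 1)); apply: lt_le_trans.
  by rewrite !mulr_gt0 ?ltr0n.
have XQ0 := lt_le_trans (exprn_gt0 2 T0) TXQ.
split; last by split; [exact: size_triples_ge|exact: TXQ|exact: coll_triples_le|
  exact: size_targets_le].
split=> //.
  rewrite lt0r ler0n andbT; apply: contraTneq XQ0 => X0.
  by rewrite /targets in X0 *; rewrite X0 mul0r ltxx.
rewrite lt0r coll_ge0 andbT; apply: contraTneq XQ0 => ->; by rewrite mulr0 ltxx.
Qed.

End Triples.
End Additive.

(** * Exponents *)

Section Logarithms.
Variable R : realType.

Lemma ln_mono (x y : R) : 0 < x -> x <= y -> ln x <= ln y.
Proof. by move=> x0 xy; rewrite ler_ln ?posrE // (lt_le_trans x0). Qed.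

(** In logarithms the hypotheses are linear. From [E <= 4 * J * p * d ^+ 2] on, they are added with
    weights 23, 23, 7, 25, 1, 24, 12, 4, 3. *)
Lemma few_sums_arith (m s E J p d D b g T X Q : R) :
  0 < m -> 0 < s -> 0 < E -> 0 < J -> 0 < p -> 0 < d -> 0 < D -> 0 < b -> 0 < g ->
  0 < T -> 0 < X -> 0 < Q ->
  E <= 4 * J * p * d ^+ 2 -> m ^+ 4 <= s * E -> p * d ^+ 3 <= D * m ^+ 2 ->
  p * d <= 2 * J * g * b -> g <= m -> m * b * g <= 2 * T -> T ^+ 2 <= X * Q ->
  Q ^+ 3 <= D ^+ 3 * m ^+ 4 * b ^+ 2 ->
  (X * m * b) ^+ 4 <= 16 * s ^+ 7 * D ^+ 2 * m * b * p ^+ 3 ->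
  94 * ln m <= 107 * ln 2 + 48 * ln J + 44 * ln s + 25 * ln D.
Proof.
move=> m0 s0 E0 J0 p0 d0 D0 b0 g0 T0 X0 Q0.
have e4 : 4 = 2 ^+ 2 :> R by ring.
have e16 : 16 = 2 ^+ 4 :> R by ring.
rewrite e4 e16; move: {e4 e16} (2 : R) (ltr0n R 2 : 0 < 2 :> R) => t t0.
move=> /(ln_mono E0) h1 /(ln_mono (exprn_gt0 4 m0)) h2.
move=> /(ln_mono (mulr_gt0 p0 (exprn_gt0 3 d0))) h3 /(ln_mono (mulr_gt0 p0 d0)) h4.
move=> /(ln_mono g0) h5 /(ln_mono (mulr_gt0 (mulr_gt0 m0 b0) g0)) h6.
move=> /(ln_mono (exprn_gt0 2 T0)) h7 /(ln_mono (exprn_gt0 3 Q0)) h8.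
move=> /(ln_mono (exprn_gt0 4 (mulr_gt0 (mulr_gt0 X0 m0) b0))).
move: h1 h2 h3 h4 h5 h6 h7 h8.
rewrite !(lnM, lnXn) ?posrE ?(mulr_gt0, exprn_gt0) //.
move: (ln t) (ln m) (ln s) (ln E) (ln J) (ln p) (ln d) (ln D) (ln b) (ln g) (ln T).
move: (ln X) (ln Q) => *; lra.
Qed.

Lemma few_sums (A S : seq R) (D : R) (J : nat) :
  uniq A -> (0 < size A)%N -> (0 < J)%N -> (size A < 2 ^ J)%N ->
  uniq S -> {in A &, forall a b, a + b \in S} -> 0 < D -> cubic A D ->
  94 * ln (size A)%:R <= 107 * ln 2 + 48 * ln J%:R + 44 * ln (size S)%:R + 25 * ln D.
Proof.
move=> uA A0 J0 AJ uS AS D0 cA.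
have [P [j [uP hE hP Pj P0]]] := popular_diffs uA A0 J0 AJ cA.
pose deg b := count (fun c => b - c \in P) A.
have degJ : {in A, forall b, (deg b < 2 ^ J)%N}.
  by move=> b _; apply: leq_ltn_trans AJ; exact: count_size.
have R2 (n : nat) : 0 < 2 ^+ n :> R by rewrite exprn_gt0.
have T0 : 0 < (size P)%:R * 2 ^+ j :> R by rewrite mulr_gt0 ?ltr0n.
(* Count the pairs [(b, c)] with [b - c] in [P] by their difference; each one occurs at least
   [2 ^ j] times. *)
have Tdeg : (size P)%:R * 2 ^+ j <= \sum_(b <- A) (deg b)%:R :> R.
  have -> : \sum_(b <- A) (deg b)%:R = \sum_(x <- P) rdif A A x.
    transitivity (\sum_(b <- A) \sum_(c <- A) \sum_(x <- P) (b - c == x)%:R : R).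
      apply: eq_bigr => b _; rewrite /deg -sum1_count natr_sum big_mkcond.
      by apply: eq_bigr => c _; rewrite sum_indic1 //; case: (_ \in P).
    transitivity (\sum_(b <- A) \sum_(x <- P) \sum_(c <- A) (b - c == x)%:R : R).
      by apply: eq_bigr => b _; rewrite exchange_big.
    rewrite exchange_big; apply: eq_bigr => x _.
    by rewrite /rdif fibE big_allpairs.
  rewrite -sum1_size natr_sum mulr_suml big_seq [leRHS]big_seq.
  by apply: ler_sum => x xP; rewrite mul1r; exact: Pj.
have [B [g [uB BA Bg B0 hB]]] := popular_degrees uA J0 degJ T0 Tdeg.
have gm : 2 ^+ g <= (size A)%:R :> R.
  have [b bB] : exists b, b \in B by case: (B) B0 => // b B' _; exists b; rewrite inE eqxx.
  rewrite -natrX ler_nat; apply: leq_trans (Bg b bB) _; exact: count_size.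
have mp : 0 < (size A)%:R :> R by rewrite ltr0n.
have bp : 0 < (size B)%:R :> R by rewrite ltr0n.
have hE4 := denergy_ge uS AS.
have E0 : 0 < denergy A A.
  rewrite lt0r coll_ge0 andbT; apply: contraTneq hE4 => ->.
  by rewrite mulr0 -ltNge exprn_gt0.
have S0 : 0 < (size S)%:R :> R.
  rewrite ltr0n lt0n; apply: contraTneq hE4 => ->.
  by rewrite mul0r -ltNge exprn_gt0.
have g0 : (0 < 2 ^ g)%N by rewrite expn_gt0.
have [T [X [Q [[T0' X0 Q0] [h1 h2 h3 h4]]]]] :=
  popular_triples uA uB uP uS BA cA AS Bg A0 B0 g0.
rewrite natrX in h1.
apply: (few_sums_arith mp S0 E0 _ _ (R2 j) D0 bp (R2 g) T0' X0 Q0 hE hE4 hP hB gm h1 h2 h3 h4);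
  by rewrite ltr0n.
Qed.

(** Again linear in logarithms; from the energy bound on, the weights are 50, 50, 100, 25, 6, 1. *)
Lemma sum_product_arith (n w E J p d t m : R) :
  0 < n -> 0 < w -> 0 < E -> 0 < J -> 0 < p -> 0 < d -> 0 < t -> 0 < m ->
  n ^+ 12 <= 2 ^+ 13 * J * n ^+ 6 * w ^+ 2 * E -> E <= 4 * J * p * d ^+ 2 ->
  p * d <= 2 * J * t * m -> t <= n -> m <= n ->
  94 * ln m <= 107 * ln 2 + 48 * ln J + 44 * ln w +
    25 * ln (2 ^+ 13 * J * n ^+ 2 * p ^+ 2 / t ^+ 3) ->
  219 * ln n <= 307 * ln 2 + 75 * ln (2 ^+ 13) + 273 * ln J + 144 * ln w.
Proof.
move=> n0 w0 E0 J0 p0 d0 t0 m0.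
have e4 : 4 = 2 ^+ 2 :> R by ring.
move: (2 ^+ 13 : R) (exprn_gt0 13 (ltr0n R 2 : 0 < 2 :> R)) => k k0.
rewrite e4; move: {e4} (2 : R) (ltr0n R 2 : 0 < 2 :> R) => c c0.
move=> /(ln_mono (exprn_gt0 12 n0)) h1 /(ln_mono E0) h2 /(ln_mono (mulr_gt0 p0 d0)) h3.
move=> /(ln_mono t0) h4 /(ln_mono m0) h5; move: h1 h2 h3 h4 h5.
rewrite ln_div ?posrE ?(mulr_gt0, exprn_gt0) //.
rewrite !(lnM, lnXn) ?posrE ?(mulr_gt0, exprn_gt0) //.
move: (ln c) (ln k) (ln n) (ln w) (ln E) (ln J) (ln p) (ln d) (ln t) (ln m) => *.
lra.
Qed.

Lemma size_ratios_le (A : seq R) : (size (ratios A) <= size A ^ 2)%N.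
Proof. by apply: leq_trans (size_undup _) _; rewrite size_map size_grid. Qed.

Lemma rdiv_mem (A : seq R) x : uniq A -> {in A, forall a, 0 < a} ->
  rdiv A x = \sum_(a <- A) (x * a \in A)%:R.
Proof.
move=> uA A0; rewrite /rdiv fibE big_allpairs exchange_big big_seq [RHS]big_seq.
apply: eq_bigr => a /A0 a0; rewrite -(sum_indic1 R _ uA); apply: eq_bigr => b _ /=.
congr (_%:R); congr nat_of_bool.
by apply/eqP/eqP => <-; [rewrite divfK ?lt0r_neq0|rewrite mulfK ?lt0r_neq0].
Qed.

(** [P] is the dyadic class of ratios that dominates the multiplicative energy, and [A'] a dyadic
    class of elements [a] by the number of [x] in [P] with [x * a] in [A]. The bound on [J] involves
    [size A ^ 2] because there may be that many ratios. *)
Lemma positive_sum_product (A W : seq R) (J : nat) :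
  uniq A -> {in A, forall a, 0 < a} -> (0 < size A)%N -> uniq W ->
  {in A & &, forall a b c, a * (b + c) \in W} -> (size A ^ 2 < 2 ^ J)%N ->
  219 * ln (size A)%:R <=
    307 * ln 2 + 75 * ln (2 ^+ 13) + 273 * ln J%:R + 144 * ln (size W)%:R :> R.
Proof.
move=> uA Apos A0 uW AW n2J.
have nJ : (size A < 2 ^ J)%N by apply: leq_ltn_trans n2J; rewrite leq_pmulr.
have J0 : (0 < J)%N by case: J n2J {nJ} => //; rewrite ltnS leqn0 expn_eq0 eqn0Ngt A0.
have np : 0 < (size A)%:R :> R by rewrite ltr0n.
have Jp : 0 < J%:R :> R by rewrite ltr0n.
have hE := mult_energy_bound uA Apos uW AW J0 nJ.
pose r x := count (fun p : R * R => p.1 / p.2 == x) (grid A A).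
have rJ : {in ratios A, forall x, (r x < 2 ^ J)%N}.
  by move=> x _; apply: leq_ltn_trans n2J; rewrite -mulnn -size_grid; exact: count_size.
have [j hj] := dyadic_level R J0 (ltn0Sn 1) rJ.
set P := [seq x <- ratios A | _] in hj.
have uP : uniq P by rewrite filter_uniq // undup_uniq.
have Pr x : x \in P -> 2 ^+ j <= rdiv A x.
  by rewrite mem_filter => /andP[/andP[h _] _]; rewrite -natrX ler_nat.
have Ppos : {in P, forall x, 0 < x}.
  by move=> x; rewrite mem_filter => /andP[_ /(ratios_gt0 Apos)].
have PJ : (size P < 2 ^ J)%N.
  apply: leq_ltn_trans n2J; apply: leq_trans (size_ratios_le A).
  by rewrite size_filter count_size.
have EP : \sum_(x <- ratios A) rdiv A x ^+ 2 <= 4 * J%:R * (size P)%:R * (2 ^+ j) ^+ 2.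
  apply: le_trans hj _.
  by rewrite [2 ^+ j.+1]exprS le_eqVlt; apply/orP; left; apply/eqP; ring.
have R2 (n : nat) : 0 < 2 ^+ n :> R by rewrite exprn_gt0.
have E0 : 0 < \sum_(x <- ratios A) rdiv A x ^+ 2.
  rewrite lt0r; apply/andP; split; last by rewrite sumr_ge0 // => x _; exact: sqr_ge0.
  by apply: contraTneq hE => ->; rewrite mulr0 -ltNge exprn_gt0.
have P0 : (0 < size P)%N.
  rewrite lt0n; apply: contraTneq (lt_le_trans E0 EP) => ->.
  by rewrite mulr0 mul0r ltxx.
have W0 : 0 < (size W)%:R :> R.
  rewrite ltr0n lt0n; apply: contraTneq hE => ->.
  by rewrite expr0n mulr0 mul0r -ltNge exprn_gt0.
pose deg a := count (fun x => x * a \in A) P.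
have degJ : {in A, forall a, (deg a < 2 ^ J)%N}.
  by move=> a _; apply: leq_ltn_trans PJ; exact: count_size.
(* The map [x -> x * a] is injective into [A]; this bounds degrees by [size A], although [P] may be
   larger. *)
have degn : {in A, forall a, (deg a <= size A)%N}.
  move=> a /Apos a0; rewrite /deg -size_filter -(size_map ( *%R^~ a)).
  apply: uniq_leq_size => [|y /mapP[x]]; last by rewrite mem_filter => /andP[xA _] ->.
  by rewrite map_inj_uniq ?filter_uniq ?undup_uniq //; exact: (mulIf (lt0r_neq0 a0)).
have T0 : 0 < (size P)%:R * 2 ^+ j :> R by rewrite mulr_gt0 ?ltr0n.
have Tdeg : (size P)%:R * 2 ^+ j <= \sum_(a <- A) (deg a)%:R :> R.
  have -> : \sum_(a <- A) (deg a)%:R = \sum_(x <- P) rdiv A x.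
    transitivity (\sum_(a <- A) \sum_(x <- P) (x * a \in A)%:R : R).
      apply: eq_bigr => a _; rewrite /deg -sum1_count natr_sum big_mkcond.
      by apply: eq_bigr => x _; case: (_ \in A).
    by rewrite exchange_big; apply: eq_bigr => x _; rewrite rdiv_mem.
  rewrite -sum1_size natr_sum mulr_suml big_seq [leRHS]big_seq.
  by apply: ler_sum => x xP; rewrite mul1r; exact: Pr.
have [A' [g [uA' A'A A'g A'0 hA']]] := popular_degrees uA J0 degJ T0 Tdeg.
have g0 : (0 < 2 ^ g)%N by rewrite expn_gt0.
have gn : 2 ^+ g <= (size A)%:R :> R.
  have [a aA'] : exists a, a \in A' by case: (A') A'0 => // a s _; exists a; rewrite inE eqxx.
  by rewrite -natrX ler_nat; apply: leq_trans (A'g a aA') (degn a (A'A a aA')).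
have mn : (size A' <= size A)%N by exact: uniq_leq_size.
pose D : R := 2 ^+ 13 * J%:R * (size A)%:R ^+ 2 * (size P)%:R ^+ 2 / (2 ^+ g) ^+ 3.
have cA' : cubic A' D.
  by rewrite /D -[in 2 ^+ g]natrX; exact: cubic_ratio uA uP uA' Apos Ppos A'A g0 J0 PJ A'g.
pose S := undup [seq p.1 + p.2 | p <- grid A A].
have AS : {in A' &, forall a b, a + b \in S}.
  move=> a b /A'A aA /A'A bA; rewrite mem_undup; apply/mapP; exists (a, b) => //.
  by rewrite mem_grid aA.
(* Multiplication by one fixed [a] embeds [A + A] into [W]. *)
have SW : (size S <= size W)%N.
  have [a aA] : exists a, a \in A by case: (A) A0 => // a s _; exists a; rewrite inE eqxx.
  rewrite -(size_map ( *%R a)); apply: uniq_leq_size => [|y /mapP[x]].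
    by rewrite map_inj_uniq ?undup_uniq //; apply: mulfI; rewrite lt0r_neq0 ?Apos.
  rewrite mem_undup => /mapP[p]; rewrite mem_grid => /andP[p1 p2] -> ->.
  exact: AW.
have Pp : 0 < (size P)%:R :> R by rewrite ltr0n.
have mp : 0 < (size A')%:R :> R by rewrite ltr0n.
have D0 : 0 < D.
  apply: divr_gt0 (exprn_gt0 3 (R2 g)); apply: mulr_gt0 (exprn_gt0 2 Pp).
  by apply: mulr_gt0 (exprn_gt0 2 np); apply: mulr_gt0 Jp; exact: R2.
have fs := few_sums uA' A'0 J0 (leq_ltn_trans mn nJ) (undup_uniq _) AS D0 cA'.
have S0 : 0 < (size S)%:R :> R.
  rewrite ltr0n; have [a aA'] : exists a, a \in A'.
    by case: (A') A'0 => // a s _; exists a; rewrite inE eqxx.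
  by have := AS a a aA' aA'; case: (S).
have lSW : ln (size S)%:R <= ln (size W)%:R :> R by apply: ln_mono; rewrite ?ler_nat.
apply: (sum_product_arith np W0 E0 Jp Pp (R2 j) (R2 g) mp hE EP hA' gn).
  by rewrite ler_nat.
by apply: le_trans fs _; rewrite lerD2r lerD2l ler_pM2l.
Qed.

End Logarithms.

(** * Reduction to positive sets and conclusion *)

Local Open Scope fset_scope.
Local Open Scope ring_scope.

Section ProductSets.
Variable R : realType.
Implicit Types A : {fset R}.

Lemma mem_prodset_sumset A (a b c : R) : a \in A -> b \in A -> c \in A ->
  a * (b + c) \in prodset A (sumset A A).
Proof. by move=> aA bA cA; rewrite in_imfset2 // in_imfset2. Qed.

(** For a nonzero [a] in [A] the map [x -> a * (a + x)] is injective. This makes the logarithm in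
    the theorem at least 1. *)
Lemma size_le_prodset A : (2 <= #|` A|)%N ->
  (#|` A| <= #|` prodset A (sumset A A)|)%N.
Proof.
move=> A2; have /hasP[a aA a0] : has (fun x => x != 0) A.
  apply: contraTT A2 => /hasPn h; rewrite -leqNgt.
  apply: (@uniq_leq_size _ (enum_fset A) [:: 0]); first exact: fset_uniq.
  by move=> x /h; rewrite inE negbK.
have inj : injective (fun x => a * (a + x)) by move=> x y /(mulfI a0)/addrI.
rewrite -[leqLHS](size_map (fun x => a * (a + x)) A).
apply: uniq_leq_size => [|y /mapP[x xA ->]]; first by rewrite map_inj_uniq // fset_uniq.
exact: mem_prodset_sumset.
Qed.

(** Take the larger of the positive part and the negated negative part; negating all three elements
    leaves [a * (b + c)] unchanged. The factor 4 leaves room for a possible zero in [A]. *)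
Lemma positive_or_negative_part A : (2 <= #|` A|)%N ->
  exists B : seq R, [/\ uniq B, {in B, forall b, 0 < b},
    (size B <= #|` A| <= 4 * size B)%N &
    {in B & &, forall a b c, a * (b + c) \in prodset A (sumset A A)}].
Proof.
move=> A2; have uA := fset_uniq A.
pose pos (x : R) := 0 < x; pose neg (x : R) := x < 0.
have sA : (#|` A| <= count pos A + count neg A + 1)%N.
  rewrite -[leqLHS](count_predC pos) -addnA leq_add2l.
  apply: (@leq_trans (count (predU neg (pred1 0%R)) A)).
    by apply: sub_count => x; rewrite /= /pos /neg; case: (ltgtP x 0).
  apply: (@leq_trans (count neg A + count (pred1 0%R) A)%N).
    by rewrite -count_predUI leq_addr.
  by rewrite leq_add2l count_uniq_mem // leq_b1.
have [h|h] := leqP (count neg A) (count pos A).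
  exists [seq x <- A | pos x]; split.
  - exact: filter_uniq.
  - by move=> x; rewrite mem_filter => /andP[].
  - rewrite size_filter count_size /=.
    by move: (count pos A) (count neg A) (size A) sA h A2 => p q s; lia.
  - move=> a b c; rewrite !mem_filter => /andP[_ aA] /andP[_ bA] /andP[_ cA].
    exact: mem_prodset_sumset.
exists [seq - x | x <- A & neg x]; split.
- by rewrite map_inj_uniq ?filter_uniq //; exact: oppr_inj.
- by move=> x /mapP[y]; rewrite mem_filter => /andP[y0 _] ->; rewrite oppr_gt0.
- rewrite size_map size_filter count_size /=.
  by move: (count pos A) (count neg A) (size A) sA h A2 => p q s; lia.
- move=> a b c /mapP[a'] + -> /mapP[b'] + -> /mapP[c'] + ->.
  rewrite !mem_filter => /andP[_ aA] /andP[_ bA] /andP[_ cA].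
  by rewrite -opprD mulrNN; exact: mem_prodset_sumset.
Qed.

End ProductSets.

Theorem theorem1p3 (R : realType) :
  exists c C : R, [/\ 0 < c, 0 < C &
    forall A : {fset R}, (2 <= #|` A|)%N ->
      let N : R := #|` prodset A (sumset A A)|%:R in
      C * ((#|` A|%:R `^ (3 / 2 + 5 / 242)) / (log2 N `^ c)) <= N].
Proof.
(* The constants of [positive_sum_product], plus [273 * ln 3] from [J <= 3 * log2 N] and
   [219 * ln 4] from [#|A| <= 4 * size B], divided by the coefficient 144 of [ln N]. *)
pose K : R := (307 * ln 2 + 75 * ln (2 ^+ 13) + 273 * ln 3 + 219 * ln 4) / 144.
exists (273 / 144), (expR (- K)); split; [by lra|exact: expR_gt0|].
move=> A A2; set W := prodset A (sumset A A); cbv zeta; set N : R := #|` W|%:R.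
have [B [uB B0 /andP[BA AB] BW]] := positive_or_negative_part A2.
have sB : (0 < size B)%N by lia.
pose J := (trunc_log 2 (size B ^ 2)).+1.
have BJ : (size B ^ 2 < 2 ^ J)%N by exact: trunc_log_ltn.
have := positive_sum_product uB B0 sB (fset_uniq W) BW BJ.
have AN : (#|` A|%:R : R) <= N by rewrite ler_nat size_le_prodset.
have A2R : 2 <= #|` A|%:R :> R by rewrite ler_nat.
have N2 : 2 <= N by exact: le_trans AN.
have ln2 : 0 < ln 2 :> R by rewrite ln_gt0 // ltr1n.
have L1 : 1 <= log2 N.
  by rewrite /log2 ler_pdivlMr // mul1r; apply: ln_mono.
have L0 : 0 < log2 N by exact: lt_le_trans ltr01 L1.
have BN : (size B)%:R <= N :> R by apply: le_trans AN; rewrite ler_nat.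
have bp : 0 < (size B)%:R :> R by rewrite ltr0n.
(* [J - 1] is at most [log2 (N ^ 2)], and the remaining 1 is at most [log2 N]. *)
have JL : J%:R <= 3 * log2 N.
  have h : (2 ^+ (trunc_log 2 (size B ^ 2)) : R) <= N ^+ 2.
    apply: (@le_trans _ _ ((size B)%:R ^+ 2)); last by rewrite lerXn2r ?nnegrE //; lra.
    by rewrite -!natrX ler_nat; apply: trunc_logP; rewrite // expn_gt0 sB.
  have := ln_mono (exprn_gt0 _ (ltr0n R 2 : 0 < 2 :> R)) h.
  rewrite !lnXn ?posrE //; last by lra.
  move=> {}h; rewrite /J -natr1.
  have : (trunc_log 2 (size B ^ 2))%:R <= 2 * log2 N.
    by rewrite /log2 mulrA ler_pdivlMr // mulr_natl mulr_natl.
  by lra.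
move=> h.
have n4 : ln (#|` A|%:R : R) <= ln 4 + ln (size B)%:R.
  rewrite -lnM ?posrE // -natrM; apply: ln_mono; first by lra.
  by rewrite ler_nat.
have hJ : ln (J%:R : R) <= ln 3 + ln (log2 N).
  by rewrite -lnM ?posrE //; apply: ln_mono.
have lnA : 0 <= ln (#|` A|%:R : R) by rewrite ln_ge0 //; lra.
have A0 : 0 < #|` A|%:R :> R by lra.
have Lc : 0 < log2 N `^ (273 / 144) by exact: powR_gt0.
have Ae : 0 < #|` A|%:R `^ (3 / 2 + 5 / 242) :> R by exact: powR_gt0.
have N0 : 0 < N by lra.
have Q0 := divr_gt0 Ae Lc.
rewrite -ler_ln ?posrE //; last by rewrite mulr_gt0 ?expR_gt0.
rewrite lnM ?posrE ?expR_gt0 // ln_div ?posrE // !ln_powR expRK /K.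
(* The proved exponent [219 / 144] exceeds [3 / 2 + 5 / 242]; as [ln #|A|] is nonnegative, the
   stated one follows. *)
move: h n4 hJ lnA; rewrite -/N.
move: (ln 2) (ln 3) (ln 4) (ln (2 ^+ 13)) (ln J%:R) (ln (size B)%:R).
move: (ln #|` A|%:R) (ln N) (ln (log2 N)).
move=> *; lra.
Qed.
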